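(* Let $G$ be a (possibly infinite-dimensional) Lie group with Lie algebra $\mathfrak g$, $K\subset G$ a subgroup with Lie algebra $\mathfrak k$, and $A:\mathfrak g\to\mathfrak g^*$ a symmetric degenerate inertia operator with $\ker A=\mathfrak k$ whose energy form $E(v)=\frac12\langle v,Av\rangle$ is invariant under $\mathrm{Ad}_k$ for all $k\in K$, so that the right-invariant form on $G$ generated by $E$ descends to a metric on the space $G/K$ of right cosets $\{Kg\}$. Put $L=\mathrm{im}\,A\subset\mathfrak g^*$. Then the Euler equation which corresponds to $A$ and describes the geodesic flow on $G/K$ has the following Hamiltonian form on $L/K=\mathrm{im}\,A/\mathrm{ad}^*K$: it is the quotient with respect to the $K$-action of the restriction to $L\subset\mathfrak g^*$ of the Hamiltonian equation $$\frac{dm}{dt}=-\mathrm{ad}^*_{A^{-1}m}m,\qquad m\in L=\mathrm{im}\,A.$$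
   Context: For $X\in\mathfrak g$, the operator $\mathrm{ad}^*_X$ on $\mathfrak g^*$ is defined by $\langle\mathrm{ad}^*_Xm,Y\rangle=\langle m,[X,Y]\rangle$. The image $L=\mathrm{im}\,A$ is identified with $(\mathfrak g/\mathfrak k)^*$, equivalently with the annihilator $\mathfrak k^\perp\subset\mathfrak g^*$ of $\mathfrak k$; it is the fiber of $T^*(G/K)$ over the identity coset $K$. The group $K$ acts on $L$ by the coadjoint action, and $L/K$ is the quotient by this action. It carries the Poisson structure induced from the Lie–Poisson structure $\{f,g\}_{LP}(m)=\langle[df,dg],m\rangle$ on $\mathfrak g^*$ (functions on $L/K$ being regarded as $K$-invariant functions on $L$). For $m\in L$ the element $A^{-1}m\in\mathfrak g$ is defined up to addition of an element of $\mathfrak k$, so the right-hand side of the equation is defined up to addition of vectors $\mathrm{ad}^*_wm$, $w\in\mathfrak k$, tangent to the $K$-orbit of $m$; the equation is therefore understood on the quotient $L/K$. The function $H_L(m)=\frac12\langle m,A^{-1}m\rangle$ on $L$ is well defined and $K$-invariant, hence it descends to $L/K$; the Hamiltonian function is minus this energy. The Euler equation for the geodesic flow on $G/K$ is the evolution equation for the velocity of a geodesic transported to the identity coset: if $g(t)\in G$ is a lift of a geodesic $Kg(t)$ and $v(t)=dR_{g(t)^{-1}}\dot g(t)\in\mathfrak g$ (where $R_h$ is right multiplication by $h$), then $m(t)=Av(t)\in L$ is defined by the geodesic up to the $K$-action, and the equation describes the evolution of its class in $L/K$. *)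

(* Defs.v *)
From HB Require Import structures.
From mathcomp Require Import all_boot all_order all_algebra.
From mathcomp Require Import all_classical all_reals all_analysis.

Set Implicit Arguments.
Unset Strict Implicit.
Unset Printing Implicit Defensive.

Import Order.TTheory GRing.Theory Num.Theory.
Import numFieldNormedType.Exports.

Local Open Scope classical_set_scope.
Local Open Scope ring_scope.

(** * Calculus in locally convex spaces (Michal-Bastiani)

   The derivatives of [derive.v] are restricted to normed modules, which
   excludes the Frechet spaces on which diffeomorphism groups are modelled. *)
Section Calculus.
Context {R : realType}.

Definition has_dirderiv (V W : tvsType R) (f : V -> W) (x v : V) (d : W) :
    Prop :=
  (fun h : R => h^-1 *: (f (x + h *: v) - f x)) @ 0^' --> d.

(** [f] is C^(n+1) on the open set [U] when it is continuous and its
   directional derivatives define a C^n map on [U * V]. *)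
Fixpoint Cn (n : nat) (V W : tvsType R) (U : set V) (f : V -> W) {struct n} :
    Prop :=
  if n is n'.+1 then
    {in U, continuous f} /\
    exists df : (V * V)%type -> W,
      (forall x v, U x -> has_dirderiv f x v (df (x, v))) /\
      Cn n' (U `*` [set: V]) df
  else {in U, continuous f}.

Definition smooth_on (V W : tvsType R) (U : set V) (f : V -> W) : Prop :=
  forall n, Cn n U f.

Definition has_velocity (E : tvsType R) (u : R -> E) (t : R) (d : E) : Prop :=
  (fun h : R => h^-1 *: (u (t + h) - u t)) @ 0^' --> d.

Definition velocity (E : tvsType R) (u : R -> E) (t : R) : E :=
  xget 0 [set d | has_velocity u t d].

Definition sym_itv (e : R) : set R := [set` `](- e), e[].

End Calculus.

(** * Lie groups modelled on a locally convex space *)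

Record chart (R : realType) (E : tvsType R) (G : groupType) := Chart {
  cdom : set G;
  cmap :> G -> E;
  cinv : E -> G;
  cmapK : forall g, cdom g -> cinv (cmap g) = g;
  cran_open : open (cmap @` cdom)
}.

Definition cran (R : realType) (E : tvsType R) (G : groupType)
  (c : chart E G) : set E := c @` cdom c.

Definition smooth_into (R : realType) (E : tvsType R) (G : groupType)
    (atlas : set (chart E G)) (V : tvsType R) (U : set V) (f : V -> G) : Prop :=
  forall x, U x -> exists2 c, atlas c & exists O : set V,
    [/\ open O, O x, O `<=` U,
        forall y, O y -> cdom c (f y) & smooth_on O (fun y => c (f y))].

(** The Hausdorff property of the group follows from that of [E].
   [chart1] identifies the Lie algebra, i.e. the tangent space at [1],
   with [E]. *)
Record lie_structure (R : realType) (E : tvsType R) (G : groupType) :=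
    LieStructure {
  atlas : set (chart E G);
  model_hausdorff : hausdorff_space E;
  atlas_cover : forall g, exists2 c, atlas c & cdom c g;
  atlas_compat : forall c d, atlas c -> atlas d ->
    open (c @` (cdom c `&` cdom d)) /\
    smooth_on (c @` (cdom c `&` cdom d)) (fun x => d (cinv c x));
  mul_smooth : forall c d, atlas c -> atlas d ->
    smooth_into atlas (cran c `*` cran d)
      (fun p : (E * E)%type => (cinv c p.1 * cinv d p.2)%g);
  inv_smooth : forall c, atlas c ->
    smooth_into atlas (cran c) (fun x => ((cinv c x)^-1)%g);
  chart1 : chart E G;
  chart1_atlas : atlas chart1;
  chart1_dom : cdom chart1 1%g;
  chart1_center : chart1 1%g = 0
}.

Section LieAlgebra.
Context {R : realType} {E : tvsType R} {G : groupType} (S : lie_structure E G).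

Definition smooth_curve (I : set R) (g : R -> G) : Prop :=
  @smooth_into R E G (atlas S) R^o I g.

(** The velocity transported to the identity by right translations:
   [dR_{g(t)^-1} (dg/dt)]. *)
Definition rvel (g : R -> G) (t : R) : E :=
  velocity (fun s => chart1 S (g s * (g t)^-1)%g) t.

Definition ray (X : E) (t : R) : G := cinv (chart1 S) (t *: X).

Definition Ad (g : G) (Y : E) : E :=
  velocity (fun s => chart1 S (g * ray Y s * g^-1)%g) 0.

Definition bracket (X Y : E) : E := velocity (fun t => Ad (ray X t) Y) 0.

Definition adstar (X : E) (m : E -> R) : E -> R := fun Y => m (bracket X Y).

Definition coad (g : G) (m : E -> R) : E -> R := fun Y => m (Ad g^-1%g Y).

Definition is_subgroup (K : set G) : Prop :=
  [/\ K 1%g, forall x y, K x -> K y -> K (x * y)%g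
    & forall x, K x -> K x^-1%g].

Definition lie_algebra_of (K : set G) : set E :=
  [set X | exists2 e : R, 0 < e & exists k : R -> G,
     [/\ smooth_curve (sym_itv e) k, forall t, sym_itv e t -> K (k t),
         k 0 = 1%g & rvel k 0 = X]].

End LieAlgebra.

(** * Degenerate inertia operators and the geometry of G/K *)

(** [A v w] is the pairing of the functional [A v] with [w].  Continuity in
   both variables means that the form generated on G is a smooth form. *)
Record inertia_operator (R : realType) (E : tvsType R) (A : E -> E -> R) :
    Prop := InertiaOperator {
  inertia_linear : forall (a : R) v w Y, A (a *: v + w) Y = a * A v Y + A w Y;
  inertia_sym : forall v w, A v w = A w v;
  inertia_continuous : continuous (fun p : (E * E)%type => A p.1 p.2)
}.

Definition energy (R : realType) (E : tvsType R) (A : E -> E -> R) (v : E) : R :=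
  2^-1 * A v v.

Section Quotient.
Context {R : realType} {E : tvsType R} {G : groupType} (S : lie_structure E G).
Context (K : set G) (A : E -> E -> R).

Definition right_coset (g : G) : set G := [set (k * g)%g | k in K].

(** [g] lifts the curve [c] of cosets over [I]. *)
Definition smooth_lift (I : set R) (c : R -> set G) (g : R -> G) : Prop :=
  smooth_curve S I g /\ forall t, I t -> c t = right_coset (g t).

(** The energy, for the metric on G/K, of the velocity of the curve [c]. *)
Definition quotient_energy (I : set R) (c : R -> set G) (t : R) : R :=
  xget 0 [set e | exists2 g, smooth_lift I c g & e = energy A (rvel S g t)].

Definition path_action (I : set R) (c : R -> set G) (a b : R) : R :=
  Rintegral lebesgue_measure `[a, b] (quotient_energy I c).

(** A variation of [c] over the open interval [J], given by its value at
   parameter [s] and time [t]; smoothness in G/K is the existence of a smooth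
   lift to G. *)
Definition smooth_variation (e : R) (J : set R) (c : R -> set G)
    (C : R -> R -> set G) : Prop :=
  (forall t, J t -> C 0 t = c t) /\
  exists2 g : (R * R)%type -> G,
    @smooth_into R E G (atlas S) (R^o * R^o)%type (sym_itv e `*` J) g &
    forall s t, sym_itv e s -> J t -> C s t = right_coset (g (s, t)).

(** Geodesics on G/K: every compact segment is critical for the action with
   respect to smooth variations with fixed end points. *)
Definition geodesic (I : set R) (c : R -> set G) : Prop :=
  (exists g, smooth_lift I c g) /\
  forall (e a b : R) (J : set R) (C : R -> R -> set G),
    0 < e -> a < b -> open J -> is_interval J ->
    [set` `[a, b]] `<=` J -> J `<=` I ->
    smooth_variation e J c C ->
    (forall s, sym_itv e s -> C s a = c a /\ C s b = c b) ->
    is_derive (0 : R) (1 : R) (fun s : R => path_action J (C s) a b) 0.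

(** ** The space L/K *)

Definition imA : set (E -> R) := range A.

(** The points of L/K are the sets [K_orbit m] with [imA m]; a function on L/K
   is a function [F] of such sets, and [F \o K_orbit] is the corresponding
   K-invariant function on L. *)
Definition K_orbit (m : E -> R) : set (E -> R) := [set coad S k m | k in K].

Definition K_invariant (f : (E -> R) -> R) : Prop :=
  forall k m, K k -> imA m -> f (coad S k m) = f m.

(** The curve [m] of L satisfies at time [t] the equation
   [dm/dt = - ad^*_v m], where [v] is one of the values of [A^-1 m]. *)
Definition euler_at (m : R -> E -> R) (t : R) (v : E) : Prop :=
  A v = m t /\
  forall Y, is_derive t (1 : R) (fun s : R => m s Y) (- adstar S v (m t) Y).

(** Solutions of the quotient of that equation: classes of differentiable
   curves of L whose velocity is, at every time, one of the values of the
   right-hand side.  Curves of L are images of curves of the Lie algebra, L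
   being identified with its quotient by the kernel of A. *)
Definition quotient_euler_solution (I : set R) (M : R -> set (E -> R)) : Prop :=
  exists u : R -> E,
    [/\ forall t, I t -> exists d, has_velocity u t d,
        forall t, I t -> M t = K_orbit (A (u t))
      & forall t, I t -> exists v, euler_at (fun s => A (u s)) t v].

(** ** The Lie-Poisson structure *)

(** [X] represents the differential at [m] of the function [f] on L.  It is an
   element of the Lie algebra defined modulo that of [K]. *)
Definition has_differential (f : (E -> R) -> R) (m : E -> R) (X : E) : Prop :=
  forall (u : R -> E) (d : E), A (u 0) = m -> has_velocity u 0 d ->
    is_derive (0 : R) (1 : R) (fun s : R => f (A (u s))) (A d X).

Definition differentiable_on_imA (f : (E -> R) -> R) : Prop :=
  forall m, imA m -> exists X, has_differential f m X.

Definition poisson (f g : (E -> R) -> R) (m : E -> R) : R :=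
  m (bracket S (xget 0 [set X | has_differential f m X])
               (xget 0 [set X | has_differential g m X])).

Definition energy_L (m : E -> R) : R :=
  2^-1 * m (xget 0 [set v | A v = m]).

(** The curve [M] of L/K is a trajectory of the Hamiltonian function given by
   the K-invariant function [H]: for every function [F] on L/K,
   [dF/dt = {H, F}], the convention for which the Hamiltonian equation on the
   dual of the Lie algebra is [dm/dt = ad^*_{dH} m]. *)
Definition hamiltonian_trajectory (H : (E -> R) -> R) (I : set R)
    (M : R -> set (E -> R)) : Prop :=
  forall F : set (E -> R) -> R, differentiable_on_imA (F \o K_orbit) ->
  forall t m, I t -> imA m -> M t = K_orbit m ->
    is_derive t (1 : R) (fun s : R => F (M s)) (poisson H (F \o K_orbit) m).

End Quotient.

(* Main.v *)
Require Import Defs.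
From HB Require Import structures.
From mathcomp Require Import all_boot all_order all_algebra.
From mathcomp Require Import all_classical all_reals all_analysis.
From mathcomp Require Import ring lra.

Set Implicit Arguments.
Unset Strict Implicit.
Unset Printing Implicit Defensive.

Import Order.TTheory GRing.Theory Num.Theory.
Import numFieldNormedType.Exports.

Local Open Scope classical_set_scope.
Local Open Scope ring_scope.

(** The statement combines a reduction by [K] and a computation of a first
   variation.

   Two lifts of a curve of G/K differ by a curve [k] of [K], which changes the
   right velocity [v] of a lift into [w + Ad k v] with [w] in the Lie algebra of
   [K], the kernel of [A].  As [A] is invariant under [K], the energy stays the
   same and the momentum [A v] moves inside its orbit ([lift_change]).
   Differentiating the invariance along curves of [K] gives
   [A [w, v] X + A v [w, X] = 0] for [w] in the Lie algebra of [K]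
   ([inertia_bracket_skew]).  It follows that a differential [X] at [m] of a
   K-invariant function satisfies [m [w, X] = 0] ([differential_lie]); this makes
   the Lie-Poisson bracket independent of the choice of differentials
   ([poissonE]).  The energy has differential [v] at [A v], so the bracket of
   minus the energy with [F] at [m = A v] is [- m [v, dF]], the derivative of [F]
   along the equation ([quotient_euler_hamiltonian]).

   For a two-parameter family in G with right velocities [xi] in [s] and [eta] in
   [t], the Maurer-Cartan equation [d eta/ds - d xi/dt = [xi, eta]]
   ([maurer_cartan]) and an integration by parts turn the derivative of the
   action into a boundary term minus the integral of
   [A (d eta/dt) xi + A eta [eta, xi]] ([first_variation]).  The integrand
   vanishes for all [xi] exactly when the Euler equation holds.  A variation of a
   curve of cosets can be lifted so as to start at a given lift of the curve, and
   at the fixed end points [xi] lies in the kernel of [A], so solutions are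
   geodesics ([euler_geodesic]).  Conversely, moving a lift along rays in a
   direction [Y], with an amplitude that vanishes at the ends of a short segment,
   tests the equation on [Y] ([geodesic_euler]).

   The group is modelled on a locally convex space which may be neither normed
   nor complete, and it may have no exponential map.  Its calculus rests on one
   estimate: if the velocity of a curve stays in an open convex set, so do its
   difference quotients ([mean_value]).  The chain rule ([chain_velocity]) and
   the symmetry of second derivatives ([schwarz]) follow.  The latter yields the
   Maurer-Cartan equation, after dividing a family by its restrictions to the two
   axes, and the antisymmetry of the bracket ([bracketC]), which is defined as a
   derivative of [Ad]. *)

(** * Mean values in locally convex spaces *)

Section MeanValue.
Context {R : realType}.
Implicit Types V W : tvsType R.

Lemma continuous_fst V W : continuous (@fst V W).
Proof. by move=> x; exact: (@cvg_fst _ _ (nbhs x.1) (nbhs x.2)). Qed.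

Lemma continuous_snd V W : continuous (@snd V W).
Proof. by move=> x; exact: (@cvg_snd _ _ (nbhs x.1) (nbhs x.2)). Qed.

Lemma continuous_compT (A B C : topologicalType) (f : A -> B) (g : B -> C) :
  continuous f -> continuous g -> continuous (fun x => g (f x)).
Proof. by move=> cf cg x; apply: continuous_comp; [exact: cf|exact: cg]. Qed.

Lemma continuous_pairT (A B C : topologicalType) (f : A -> B) (g : A -> C) :
  continuous f -> continuous g -> continuous (fun x => (f x, g x)).
Proof. by move=> cf cg x; apply: cvg_pair; [exact: cf|exact: cg]. Qed.

Lemma cvgD_tvs V (T : Type) (F : set_system T) {FF : Filter F}
    (f g : T -> V) a b :
  f @ F --> a -> g @ F --> b -> (fun x => f x + g x) @ F --> a + b.
Proof.
move=> fa gb.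
exact: cvg_comp (cvg_pair fa gb) (@add_continuous V (a, b)).
Qed.

Lemma cvgZ_tvs V (T : Type) (F : set_system T) {FF : Filter F}
    (k : T -> R) (f : T -> V) (c : R) (a : V) :
  k @ F --> c -> f @ F --> a -> (fun x => k x *: f x) @ F --> c *: a.
Proof.
move=> kc fa.
exact: cvg_comp (cvg_pair kc fa) (@scale_continuous R V (c, a)).
Qed.

(** The library's [convex_set] takes its coefficient in a subtype of the unit
   interval; a real coefficient is easier to compute with. *)
Definition convex V (C : set V) := forall x y (l : R), 0 <= l <= 1 ->
  C x -> C y -> C (l *: x + (1 - l) *: y).

Lemma nbhs_convex V (x : V) (N : set V) : nbhs x N ->
  exists C, [/\ open C, C x, C `<=` N & convex C].
Proof.
have [B Bc [Bo Bb]] := @locally_convex R V.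
move=> /Bb [C /= [BC Cx] CN]; exists C; split => //; first exact: Bo.
move=> y z l l01 Cy Cz.
have /andP[l0 l1] := l01.
have l01' : Itv.spec (@Itv.num_sem R) (Itv.Real `[0%Z, 1%Z]%O) l.
  by rewrite /= /Itv.num_sem /= in_itv /= l0 l1 num_real.
have := Bc C (mem_set BC) y z (Itv.mk l01') (mem_set Cy) (mem_set Cz).
by rewrite inE.
Qed.

Definition slope V (f : R -> V) (x y : R) : V := (y - x)^-1 *: (f y - f x).

Lemma slopeC V (f : R -> V) x y : slope f x y = slope f y x.
Proof.
by rewrite /slope -opprB invrN scaleNr -scalerN opprB.
Qed.

(** The slope over [[a, y]] is a barycentre of the slopes over [[a, x]] and
   [[x, y]]. *)
Lemma slope_convex V (f : R -> V) (C : set V) a x y : convex C ->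
  a < x -> x < y -> C (slope f a x) -> C (slope f x y) -> C (slope f a y).
Proof.
move=> Cc ax xy Cax Cxy.
have ax0 : x - a != 0 by lra.
have xy0 : y - x != 0 by lra.
have ay0 : y - a != 0 by lra.
suff -> : slope f a y = ((x - a) / (y - a)) *: slope f a x +
    (1 - (x - a) / (y - a)) *: slope f x y.
  apply: Cc => //; apply/andP; split; first by apply: divr_ge0; lra.
  by rewrite ler_pdivrMr; lra.
rewrite /slope !scalerA.
have -> : (x - a) / (y - a) / (x - a) = (y - a)^-1 by field; apply/andP.
have -> : (1 - (x - a) / (y - a)) / (y - x) = (y - a)^-1 by field; apply/andP.
by rewrite -scalerDr; congr (_ *: _); rewrite [RHS]addrC addrA subrK.
Qed.

(** Let [c] be the supremum of the points up to which all slopes from [a] lie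
   in [C]. The slopes from [c] to nearby points lie in [C] because [C] is
   open, and barycentres of slopes stay in [C] because it is convex; so [c]
   cannot be smaller than [b]. *)
Theorem mean_value V (f : R -> V) (a b : R) (C : set V) : a < b ->
  open C -> convex C ->
  (forall s, a <= s <= b -> exists2 d, C d & has_velocity f s d) ->
  C (slope f a b).
Proof.
move=> ab Co Cc fd.
have loc s : a <= s <= b -> exists2 e : R, 0 < e &
    forall y, y != s -> `|y - s| < e -> C (slope f s y).
  move=> /fd [d Cd /(_ C)]; rewrite /= => /(_ (open_nbhs_nbhs (conj Co Cd))).
  move=> [e /= e0 H]; exists e => // y ys yse.
  have := H (y - s); rewrite /= sub0r normrN subr_eq0 => /(_ yse ys).
  by rewrite /slope (addrC s) subrK.
pose T := [set x | a <= x <= b /\ forall y, a < y -> y <= x -> C (slope f a y)].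
have Ta : T a by split; [lra|move=> y; lra].
have Tb : ubound T b by move=> x [/andP[]].
have supT : has_sup T by split; [exists a|exists b].
pose c := sup T.
have ac : a <= c by exact: ub_le_sup (ex_intro _ b Tb) _ Ta.
have cb : c <= b by apply: ge_sup => //; exists a.
have [e e0 He] := loc c ltac:(lra).
have lt_c y : a < y -> y < c -> C (slope f a y).
  move=> ay yc; have [x [_ Tx] yx] := sup_adherent (ltac:(lra) : 0 < c - y) supT.
  by apply: Tx => //; rewrite -/c in yx; lra.
have le_c y : a < y -> y <= c -> C (slope f a y).
  rewrite le_eqVlt => ay /orP[/eqP yc|]; last exact: lt_c.
  rewrite yc in ay *; pose x := Num.max (c - e / 2) ((a + c) / 2).
  have [x1 x2] : a < x /\ x < c /\ c - e / 2 <= x.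
    by rewrite /x; case: (leP (c - e / 2) ((a + c) / 2)) => ?; lra.
  apply: (slope_convex Cc x1) => //; [lra|apply: lt_c; lra|].
  rewrite slopeC; apply: He; first by lra.
  by rewrite ltr_norml; lra.
have lt_ce y : a < y -> y < c + e -> C (slope f a y).
  move=> ay yce; case: (leP y c) => yc; first exact: le_c.
  have Ccy : C (slope f c y) by apply: He; [lra|rewrite ltr_norml; lra].
  have [ac'|ac'] := eqVneq a c; first by rewrite ac'.
  by apply: (slope_convex Cc _ yc _ Ccy); [|apply: le_c]; lra.
have [bc|bc] := leP b c; first by apply: le_c; lra.
pose x := Num.min b (c + e / 2).
have [x1 [x2 x3]] : c < x /\ x <= b /\ x < c + e.
  by rewrite /x; case: (leP b (c + e / 2)) => ?; lra.
have Tx : T x by split; [lra|move=> y ay yx; apply: lt_ce; lra].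
by have := ub_le_sup (ex_intro _ b Tb) Tx; rewrite -/c; lra.
Qed.

End MeanValue.

(** * Velocities of curves *)

Section Velocities.
Context {R : realType}.
Implicit Types V W : tvsType R.

Lemma cvg_eqfun (T : Type) V (F : set_system T) (f g : T -> V) (l : V) :
  f @ F --> l -> f =1 g -> g @ F --> l.
Proof. by move=> fl /funext <-. Qed.

Lemma cvg_neareq (T : Type) V (F : set_system T) {FF : Filter F} (f g : T -> V) (l : V) :
  f @ F --> l -> (\forall x \near F, f x = g x) -> g @ F --> l.
Proof. by move=> fl fg; apply: cvg_trans fl; apply: near_eq_cvg. Qed.

Lemma eq_velocity V (u w : R -> V) t : u =1 w -> velocity u t = velocity w t.
Proof. by move=> /funext ->. Qed.

Lemma eq_has_velocity V (u w : R -> V) t d :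
  u =1 w -> has_velocity u t d -> has_velocity w t d.
Proof. by move=> /funext ->. Qed.

Lemma eq_has_velocity2 V (u w : R -> V) t d d' :
  u =1 w -> d = d' -> has_velocity u t d -> has_velocity w t d'.
Proof. by move=> /funext -> ->. Qed.

(** Reduces directional derivatives to velocities of curves, for which the
   rules of calculus are proved below. *)
Lemma has_dirderiv_line V W (f : V -> W) x v s d :
  has_dirderiv f (x + s *: v) v d <->
  has_velocity (fun r => f (x + r *: v)) s d.
Proof.
rewrite /has_dirderiv /has_velocity.
suff -> : (fun h : R => h^-1 *: (f (x + s *: v + h *: v) - f (x + s *: v))) =
  (fun h : R => h^-1 *: (f (x + (s + h) *: v) - f (x + s *: v))) by [].
by apply/funext => h; rewrite scalerDl addrA.
Qed.

Lemma has_dirderiv_line0 V W (f : V -> W) x v d :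
  has_dirderiv f x v d <-> has_velocity (fun r => f (x + r *: v)) 0 d.
Proof. by rewrite -has_dirderiv_line scale0r addr0. Qed.

Lemma has_velocity_unique V (u : R -> V) t d d' : hausdorff_space V ->
  has_velocity u t d -> has_velocity u t d' -> d = d'.
Proof. by move=> hV ud ud'; apply: (cvg_unique hV ud ud'). Qed.

Lemma velocityP V (u : R -> V) t d : hausdorff_space V ->
  has_velocity u t d -> velocity u t = d.
Proof.
move=> hV ud; apply: (has_velocity_unique hV _ ud).
exact: (@xgetPex _ 0 [set d | has_velocity u t d] (ex_intro _ d ud)).
Qed.

Lemma has_velocity_near V (u u' : R -> V) t d :
  (\forall s \near t, u s = u' s) -> has_velocity u t d -> has_velocity u' t d.
Proof.
move=> uu'; apply: cvg_trans; apply: near_eq_cvg.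
have uut := nbhs_singleton uu'.
have : \forall h \near (0 : R), u (t + h) = u' (t + h).
  have : (fun h => t + h) @ (0 : R) --> t.
    by rewrite -[X in _ --> X]addr0; apply: cvgD; [exact: cvg_cst|exact: cvg_id].
  by move=> /(_ _ uu').
move=> H; apply: nbhs_dnbhs; apply: filterS H => h.
by rewrite uut => ->.
Qed.

Lemma has_velocity_cst V (c : V) t : has_velocity (fun=> c) t 0.
Proof.
rewrite /has_velocity (_ : (fun _ => _) = cst 0); first exact: cvg_cst.
by apply/funext => h; rewrite subrr scaler0.
Qed.

Lemma has_velocityD V (u w : R -> V) t d d' :
  has_velocity u t d -> has_velocity w t d' ->
  has_velocity (fun s => u s + w s) t (d + d').
Proof.
move=> ud wd'; apply: cvg_eqfun (cvgD_tvs ud wd') _ => h.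
by rewrite -scalerDr opprD addrACA.
Qed.

Lemma has_velocityZ V (a : R) (u : R -> V) t d :
  has_velocity u t d -> has_velocity (fun s => a *: u s) t (a *: d).
Proof.
move=> ud; apply: cvg_eqfun (cvgZ_tvs (cvg_cst a) ud) _ => h.
by rewrite -scalerBr !scalerA mulrC.
Qed.

Lemma dnbhs_scale (a : R) : a != 0 -> (fun h => a * h) @ 0^' --> (0 : R)^'.
Proof.
move=> a0 P [e /= e0 He]; exists (e / `|a|) => /=.
  by rewrite divr_gt0 // normr_gt0.
move=> h /=; rewrite sub0r normrN => he h0; apply: He => /=.
  by rewrite sub0r normrN normrM mulrC -ltr_pdivlMr ?normr_gt0.
by rewrite mulf_neq0.
Qed.

Lemma has_velocity_affine V (u : R -> V) (a b t : R) d :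
  has_velocity u (b + a * t) d ->
  has_velocity (fun s => u (b + a * s)) t (a *: d).
Proof.
move=> ud; have [->|a0] := eqVneq a 0.
  rewrite scale0r; under eq_fun do rewrite mul0r; exact: has_velocity_cst.
apply: cvg_neareq (cvgZ_tvs (cvg_cst a) (@cvg_comp _ _ _ (fun h => a * h)
  (fun h => h^-1 *: (u (b + a * t + h) - u (b + a * t))) _ _ _
  (dnbhs_scale a0) ud)) _.
near=> h; rewrite /= scalerA invfM mulrA divff // mul1r.
by rewrite mulrDr addrA.
Unshelve. all: by end_near. Qed.

Lemma has_velocity_shift V (u : R -> V) (b t : R) d :
  has_velocity u (b + t) d -> has_velocity (fun s => u (b + s)) t d.
Proof.
move=> ud; have := @has_velocity_affine V u 1 b t d; rewrite mul1r scale1r.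
by move=> /(_ ud); under eq_fun do rewrite mul1r.
Qed.

Lemma has_velocity_line V (x v : V) t : has_velocity (fun s => x + s *: v) t v.
Proof.
apply: (@cvg_neareq _ _ _ _ (fun=> v)); first exact: cvg_cst.
near=> h; rewrite /= scalerDl addrA [_ + h *: v]addrC addrK.
rewrite scalerA mulVf ?scale1r //; near: h; exact: nbhs_dnbhs_neq.
Unshelve. all: by end_near. Qed.

Lemma has_velocity_pair V W (u : R -> V) (w : R -> W) t d d' :
  has_velocity u t d -> has_velocity w t d' ->
  has_velocity (fun s => (u s, w s)) t (d, d').
Proof. by move=> ud wd; exact: (cvg_pair ud wd). Qed.

Lemma has_velocity_id (t : R) : @has_velocity R R^o id t 1.
Proof.
apply: eq_has_velocity (@has_velocity_line R^o 0 1 t) => s.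
by rewrite add0r /GRing.scale /= mulr1.
Qed.

Lemma has_velocity_cont V (u : R -> V) t d :
  has_velocity u t d -> {for t, continuous u}.
Proof.
move=> ud.
have ut : (fun h => u t + h *: (h^-1 *: (u (t + h) - u t))) @ 0^' --> u t.
  rewrite -[X in _ --> X]addr0 -(scale0r d).
  apply: cvgD_tvs; first exact: cvg_cst.
  by by apply: cvgZ_tvs => //; exact: nbhs_dnbhs.
have {ut} : (fun h => u (t + h)) @ 0^' --> u t.
  apply: cvg_neareq ut _; near=> h => /=.
  rewrite scalerA divff ?scale1r; first by rewrite addrC subrK.
  near: h; exact: nbhs_dnbhs_neq.
move=> H; apply/(continuous_withinNx u t) => P /H [e /= e0 He].
exists e => //= s /= tse st; rewrite -[s](subrK t) addrC.
apply: He; last by rewrite subr_eq0.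
by rewrite /= sub0r normrN distrC.
Unshelve. all: by end_near. Qed.

End Velocities.

(** * The chain rule *)

Section ContinuouslyDifferentiable.
Context {R : realType}.
Implicit Types V W X : tvsType R.

(** What the chain rule needs to know of a derivative; [Cn n.+1] provides it.
   *)
Definition C1 V W (U : set V) (f : V -> W) (df : V * V -> W) : Prop :=
  [/\ open U, forall x v, U x -> has_dirderiv f x v (df (x, v)) &
      forall x v, U x -> {for (x, v), continuous df}].

(** Difference quotients converge uniformly in the base point and in the
   direction: by [mean_value], the quotient at [y] along [h *: w] lies in
   every convex neighbourhood of [df (x, v)] which contains the values [df (y
   + s *: w, w)] for [s] between [0] and [h]. The chain rule and the linearity
   of the derivative are consequences. *)
Lemma strict_dirderiv V W (U : set V) (f : V -> W) df x v :
  C1 U f df -> U x ->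
  (fun p : (V * V) * R => p.2^-1 *: (f (p.1.1 + p.2 *: p.1.2) - f p.1.1))
    @ filter_prod (nbhs (x, v)) 0^' --> df (x, v).
Proof.
move=> [oU fd cdf] Ux N /nbhs_convex [C [oC Cx CN cC]].
have cU : nbhs x U by exact: open_nbhs_nbhs.
have c11 := continuous_compT (@continuous_fst _ (V * V)%type R^o)
  (@continuous_fst _ V V).
have c12 := continuous_compT (@continuous_fst _ (V * V)%type R^o)
  (@continuous_snd _ V V).
have cv : continuous (fun q : (V * V) * R^o => (q.1.1 + q.2 *: q.1.2, q.1.2)).
  move=> q; apply: cvg_pair => /=; last exact: (c12 q).
  apply: cvgD_tvs; first exact: (c11 q).
  apply: cvgZ_tvs; last exact: (c12 q).
  exact: (@continuous_snd _ (V * V)%type R^o q).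
have /(cv ((x, v), 0)) : nbhs (x + 0 *: v, v)
    [set q | U q.1 /\ C (df q)].
  rewrite scale0r addr0; apply: filterI.
    by exists (U, setT); [split => //; exact: filterT|move=> [a b] []].
  by apply: cdf => //; exact: open_nbhs_nbhs.
move=> [[P I] /= [Oxv [e /= e0 He]] PI].
exists (P, [set h | `|h| < e /\ h != 0]) => /=.
  by split => //; exists e => // h /=; rewrite sub0r normrN; split.
move=> [[y w] h] /= [Oyw [he h0]]; apply: CN.
have sd s : `|s| <= `|h| -> exists2 d, C d & has_velocity (fun s => f (y + s *: w)) s d.
  move=> sh; have /= [|Us Cs] := PI ((y, w), s).
    split => //; apply: He; rewrite /= sub0r normrN; exact: le_lt_trans he.
  exists (df (y + s *: w, w)) => //.
  by apply/has_dirderiv_line; exact: fd.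
have E : h^-1 *: (f (y + h *: w) - f y) = slope (fun s => f (y + s *: w)) 0 h.
  by rewrite /slope subr0 scale0r addr0.
rewrite E; have [h1|h1] := ltP 0 h.
  apply: mean_value => // s /andP[s0 sh]; apply: sd.
  by rewrite !ger0_norm // ltW.
rewrite slopeC; apply: mean_value => //; first by rewrite lt_neqAle h0.
by move=> s /andP[s0 sh]; apply: sd; rewrite !ler0_norm // lerN2.
Qed.

(** The difference quotient of the composite is a quotient of [f] at [u t]
   whose direction, the quotient of [u], converges to [d]. *)
Lemma chain_velocity V W (U : set V) (f : V -> W) df (u : R -> V) t d :
  C1 U f df -> U (u t) -> has_velocity u t d ->
  has_velocity (fun s => f (u s)) t (df (u t, d)).
Proof.
move=> Cf Ut ud.
have H : (fun h => ((u t, h^-1 *: (u (t + h) - u t)), h)) @ (0 : R)^' -->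
    filter_prod (nbhs (u t, d)) (0 : R)^'.
  exact: (cvg_pair (cvg_pair (cvg_cst (u t)) ud) cvg_id).
apply: cvg_neareq (cvg_comp _ _ H (strict_dirderiv (v := d) Cf Ut)) _.
near=> h; rewrite /= scalerA divff ?scale1r; last first.
  by near: h; exact: nbhs_dnbhs_neq.
by rewrite [X in f X]addrC subrK.
Unshelve. all: by end_near. Qed.

Lemma C1_scale V W (U : set V) (f : V -> W) df x v a : hausdorff_space W ->
  C1 U f df -> U x -> df (x, a *: v) = a *: df (x, v).
Proof.
move=> hW [_ fd _] Ux; apply: (cvg_unique hW (fd x (a *: v) Ux)).
have H0 : has_velocity (fun r => f (x + r *: v)) (0 + a * 0) (df (x, v)).
  by rewrite mulr0 addr0; apply/has_dirderiv_line0; exact: fd.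
have H := has_velocity_affine H0.
apply/has_dirderiv_line0.
by apply: cvg_eqfun H _ => h; rewrite !add0r !mulr0 !scalerA mul0r (mulrC a).
Qed.

(** The increment of [f] along [h *: (v + w)] is its increment along [h *: v],
   followed by its increment along [h *: w] from the moving base point [x + h
   *: v]. *)
Lemma C1_add V W (U : set V) (f : V -> W) df x v w : hausdorff_space W ->
  C1 U f df -> U x -> df (x, v + w) = df (x, v) + df (x, w).
Proof.
move=> hW Cf Ux; have [_ fd _] := Cf; apply: (cvg_unique hW (fd x (v + w) Ux)).
have H : (fun h => ((x + h *: v, w), h)) @ (0 : R)^' -->
    filter_prod (nbhs (x, w)) (0 : R)^'.
  suff xv : (fun h => x + h *: v) @ (0 : R)^' --> x.
    exact: (cvg_pair (cvg_pair xv (cvg_cst w)) cvg_id).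
  have : (fun h => x + h *: v) @ (0 : R) --> x + 0 *: v.
    exact: has_velocity_cont (@has_velocity_line R V x v 0).
  rewrite scale0r addr0 => H; apply: cvg_trans H; apply: cvg_app.
  exact: nbhs_dnbhs.
apply: cvg_eqfun (cvgD_tvs (fd x v Ux)
  (cvg_comp _ _ H (strict_dirderiv (v := w) Cf Ux))) _ => h /=.
rewrite -scalerDr; congr (_ *: _).
by rewrite scalerDr [x + (_ + _)]addrA [LHS]addrC addrA subrK.
Qed.

End ContinuouslyDifferentiable.

(** * Maps of class C^n *)

Section SmoothMaps.
Context {R : realType}.
Implicit Types V W X : tvsType R.

Lemma openX V W (U : set V) (U' : set W) : open U -> open U' -> open (U `*` U').
Proof.
move=> oU oU'; rewrite openE => -[x y] [/= Ux U'y].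
by exists (U, U') => //=; split; exact: open_nbhs_nbhs.
Qed.

Lemma openXT V W (U : set V) : open U -> open (U `*` [set: W]).
Proof. by move=> oU; apply: openX => //; exact: openT. Qed.

Lemma Cn_cont n V W (U : set V) (f : V -> W) x : Cn n U f -> U x ->
  {for x, continuous f}.
Proof. by case: n => [|n] /= => [cf|[cf _]] Ux; apply: cf; exact/mem_set. Qed.

Lemma Cn_C1 n V W (U : set V) (f : V -> W) : open U -> Cn n.+1 U f ->
  exists2 df, C1 U f df & Cn n (U `*` setT) df.
Proof.
move=> oU [cf [df [fd Cdf]]]; exists df => //; split => // x v Ux.
by apply: (Cn_cont Cdf).
Qed.

Lemma Cn_le n V W (U : set V) (f : V -> W) : Cn n.+1 U f -> Cn n U f.
Proof.
elim: n V W U f => [|n IH] V W U f [cf [df [fd Cdf]]] //.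
by split => //; exists df; split => //; exact: IH.
Qed.

Lemma Cn_sub n V W (U U' : set V) (f : V -> W) : U' `<=` U ->
  Cn n U f -> Cn n U' f.
Proof.
elim: n V W U U' f => [|n IH] V W U U' f UU' /=.
  by move=> cf x /set_mem /UU' Ux; apply: cf; exact/mem_set.
move=> [cf [df [fd Cdf]]]; split.
  by move=> x /set_mem /UU' Ux; apply: cf; exact/mem_set.
exists df; split; first by move=> x v /UU'; exact: fd.
by apply: IH Cdf => -[x v] [/= /UU'].
Qed.

Lemma has_dirderiv_near V W (f g : V -> W) x v d :
  (\forall y \near x, f y = g y) -> has_dirderiv f x v d -> has_dirderiv g x v d.
Proof.
move=> fg /has_dirderiv_line0 fd; apply/has_dirderiv_line0.
apply: has_velocity_near fd.
have : (fun h => x + h *: v) @ (0 : R) --> x + 0 *: v.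
  exact: has_velocity_cont (@has_velocity_line R V x v 0).
by rewrite scale0r addr0 => /(_ _ fg).
Qed.

Lemma continuous_near V W (f g : V -> W) x :
  (\forall y \near x, f y = g y) -> {for x, continuous f} ->
  {for x, continuous g}.
Proof.
move=> fg cf; rewrite /prop_for /continuous_at -(nbhs_singleton fg).
exact: cvg_neareq cf fg.
Qed.

Lemma Cn_eq n V W (U : set V) (f g : V -> W) : open U ->
  (forall x, U x -> f x = g x) -> Cn n U f -> Cn n U g.
Proof.
move=> oU fg.
have nfg x : U x -> \forall y \near x, f y = g y.
  by move=> Ux; apply: filterS (open_nbhs_nbhs (conj oU Ux)); exact: fg.
have cg : {in U, continuous f} -> {in U, continuous g}.
  by move=> cf x xU; apply: continuous_near (nfg _ (set_mem xU)) _; exact: cf.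
case: n => [|n] //= [cf [df [fd Cdf]]]; split; first exact: cg.
exists df; split => // x v Ux.
by apply: has_dirderiv_near (nfg _ Ux) _; exact: fd.
Qed.

(** Unbundled, since the maps of interest, such as [Ad g] or the functional [A
   v], are given as plain functions. *)
Definition linear_map V W (L : V -> W) :=
  forall (a : R) x y, L (a *: x + y) = a *: L x + L y.

Lemma linear_map0 V W (L : V -> W) : linear_map L -> L 0 = 0.
Proof.
move=> lL; have := lL (-1) 0 0; rewrite scaler0 addr0 => {1}->.
by rewrite scaleN1r addNr.
Qed.

Lemma linear_mapZ V W (L : V -> W) a x : linear_map L -> L (a *: x) = a *: L x.
Proof. by move=> lL; rewrite -[a *: x]addr0 lL linear_map0 // addr0. Qed.

Lemma linear_mapD V W (L : V -> W) x y : linear_map L -> L (x + y) = L x + L y.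
Proof. by move=> lL; rewrite -[x]scale1r lL !scale1r. Qed.

Lemma linear_mapN V W (L : V -> W) x : linear_map L -> L (- x) = - L x.
Proof. by move=> lL; rewrite -scaleN1r linear_mapZ // scaleN1r. Qed.

Lemma linear_mapB V W (L : V -> W) x y : linear_map L -> L (x - y) = L x - L y.
Proof. by move=> lL; rewrite linear_mapD // linear_mapN. Qed.

Lemma has_velocity_linear V W (L : V -> W) (u : R -> V) t d : linear_map L ->
  continuous L -> has_velocity u t d -> has_velocity (fun s => L (u s)) t (L d).
Proof.
move=> lL cL ud; apply: cvg_eqfun (continuous_cvg _ (cL d) ud) _ => h /=.
by rewrite linear_mapZ // linear_mapB.
Qed.

Lemma continuous_scalel V (v : V) : continuous (fun s : R^o => s *: v).
Proof.
move=> s; have cs : (fun s : R => s) @ (s : R) --> s by exact: cvg_id.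
exact: (cvgZ_tvs cs (cvg_cst v)).
Qed.

Lemma Cn_linear n V W (L : V -> W) U : linear_map L -> continuous L -> Cn n U L.
Proof.
elim: n V W L U => [|n IH] V W L U lL cL /=; first by move=> x _; exact: cL.
split; first by move=> x _; exact: cL.
exists (fun p => L p.2); split; last first.
  apply: IH; first by move=> a x y; exact: lL.
  exact: continuous_compT (@continuous_snd _ V V) cL.
move=> x v _; apply/has_dirderiv_line0; apply: has_velocity_linear => //.
exact: has_velocity_line.
Qed.

Lemma Cn_cst n V W (c : W) (U : set V) : Cn n U (fun=> c).
Proof.
elim: n V c U => [|n IH] V c U /=; first by move=> x _; exact: cvg_cst.
split; first by move=> x _; exact: cvg_cst.
exists (fun=> 0); split; last exact: IH.
by move=> x v _; apply/has_dirderiv_line0; exact: has_velocity_cst.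
Qed.

Lemma Cn_pair n V W X (U : set V) (f : V -> W) (g : V -> X) :
  Cn n U f -> Cn n U g -> Cn n U (fun x => (f x, g x)).
Proof.
elim: n V W X U f g => [|n IH] V W X U f g /=.
  by move=> cf cg x xU; apply: cvg_pair; [exact: cf|exact: cg].
move=> [cf [df [fd Cdf]]] [cg [dg [gd Cdg]]]; split.
  by move=> x xU; apply: cvg_pair; [exact: cf|exact: cg].
exists (fun p => (df p, dg p)); split; last exact: IH.
by move=> x v Ux; exact: cvg_pair (fd x v Ux) (gd x v Ux).
Qed.

(** The derivative [(x, v) |-> dg (f x, df (x, v))] of the composite is again
   a composite, of maps of one class lower. *)
Lemma Cn_comp n V W X (U : set V) (U' : set W) (f : V -> W) (g : W -> X) :
  open U -> open U' -> (forall x, U x -> U' (f x)) ->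
  Cn n U f -> Cn n U' g -> Cn n U (fun x => g (f x)).
Proof.
elim: n V W X U U' f g => [|n IH] V W X U U' f g oU oU' UU' Cf Cg.
  move=> x /set_mem Ux; apply: (cvg_comp _ _ (Cn_cont Cf Ux)).
  by apply: (Cn_cont Cg); exact: UU'.
have [df C1f Cdf] := Cn_C1 oU Cf; have [dg C1g Cdg] := Cn_C1 oU' Cg.
split.
  move=> x /set_mem Ux; apply: (cvg_comp _ _ (Cn_cont Cf Ux)).
  by apply: (Cn_cont Cg); exact: UU'.
exists (fun p => dg (f p.1, df p)); split.
  move=> x v Ux; apply/has_dirderiv_line0.
  have /has_dirderiv_line0 fd : has_dirderiv f x v (df (x, v)).
    by have [_ + _] := C1f; apply.
  have := chain_velocity C1g _ fd; rewrite /= scale0r addr0; apply; exact: UU'.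
apply: (IH _ _ _ (U `*` setT) (U' `*` setT) (fun p => (f p.1, df p))) => //.
- exact: openXT.
- exact: openXT.
- by move=> [x v] [/= Ux _]; split => //=; exact: UU'.
apply: Cn_pair => //.
apply: (IH _ _ _ (U `*` setT) U fst f) => //.
- exact: openXT.
- by move=> [x v] [].
- by apply: Cn_linear; [move=> a x y|exact: continuous_fst].
- exact: Cn_le.
Qed.

Definition bilinear_map V W X (b : V -> W -> X) :=
  (forall x, linear_map (b x)) /\ (forall y, linear_map (b^~ y)).

Lemma has_velocity_bilinear V W X (b : V -> W -> X) (u : R -> V) (w : R -> W)
    t d d' : bilinear_map b -> continuous (fun p : V * W => b p.1 p.2) ->
  has_velocity u t d -> has_velocity w t d' ->
  has_velocity (fun s => b (u s) (w s)) t (b (u t) d' + b d (w t)).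
Proof.
move=> [bl br] cb ud wd.
have ut : (fun h => u (t + h)) @ (0 : R)^' --> u t.
  have : (fun h => u (t + h)) @ (0 : R) --> u (t + 0).
    apply: (has_velocity_cont (d := d)).
    by apply: has_velocity_shift; rewrite addr0.
  rewrite addr0.
  by apply: cvg_trans; apply: cvg_app; exact: nbhs_dnbhs.
have H1 : (fun h => b (u (t + h)) (h^-1 *: (w (t + h) - w t))) @ (0 : R)^'
    --> b (u t) d' by exact: cvg_comp (cvg_pair ut wd) (cb (u t, d')).
have H2 : (fun h => b (h^-1 *: (u (t + h) - u t)) (w t)) @ (0 : R)^'
    --> b d (w t).
  exact: cvg_comp (cvg_pair ud (cvg_cst (w t))) (cb (d, w t)).
apply: cvg_eqfun (cvgD_tvs H1 H2) _ => h /=.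
rewrite (linear_mapZ _ _ (bl _)) (linear_mapZ _ _ (br _)) -scalerDr.
congr (_ *: _).
by rewrite (linear_mapB _ _ (bl _)) (linear_mapB _ _ (br _)) addrA subrK.
Qed.

Lemma Cn_add n V W (U : set V) (f g : V -> W) : open U ->
  Cn n U f -> Cn n U g -> Cn n U (fun x => f x + g x).
Proof.
move=> oU Cf Cg.
apply: (@Cn_comp n _ _ _ U setT (fun x => (f x, g x)) (fun p => p.1 + p.2)) => //.
- exact: openT.
- exact: Cn_pair.
- apply: Cn_linear; last exact: add_continuous.
  by move=> a x y /=; rewrite scalerDr addrACA.
Qed.

(** The derivative of a bilinear map is a sum of composites of the same map
   with projections, so the induction on the class closes up. *)
Lemma Cn_bilinear n V W X (b : V -> W -> X) U :
  bilinear_map b -> continuous (fun p : V * W => b p.1 p.2) ->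
  Cn n U (fun p : V * W => b p.1 p.2).
Proof.
move=> bb cb; suff : Cn n setT (fun p : V * W => b p.1 p.2) by exact: Cn_sub.
elim: n => [|n IH] /=; first by move=> x _; exact: cb.
split; first by move=> x _; exact: cb.
exists (fun q => b q.1.1 q.2.2 + b q.2.1 q.1.2); split.
  move=> [x y] [v w] _ /=; apply/has_dirderiv_line0.
  have := has_velocity_bilinear bb cb (@has_velocity_line _ _ x v 0)
    (@has_velocity_line _ _ y w 0).
  by rewrite !scale0r !addr0.
have oT : open ([set: V * W] `*` [set: V * W]) by apply: openXT; exact: openT.
apply: Cn_add => //.
- apply: (@Cn_comp n _ _ _ _ setT (fun q : (V * W) * (V * W) => (q.1.1, q.2.2)) _) IH => //.
    exact: openT.
  apply: Cn_linear; first by move=> a x y.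
  apply: continuous_pairT.
    exact: continuous_compT (@continuous_fst _ _ _) (@continuous_fst _ _ _).
  exact: continuous_compT (@continuous_snd _ _ _) (@continuous_snd _ _ _).
- apply: (@Cn_comp n _ _ _ _ setT (fun q : (V * W) * (V * W) => (q.2.1, q.1.2)) _) IH => //.
    exact: openT.
  apply: Cn_linear; first by move=> a x y.
  apply: continuous_pairT.
    exact: continuous_compT (@continuous_snd _ _ _) (@continuous_fst _ _ _).
  exact: continuous_compT (@continuous_fst _ _ _) (@continuous_snd _ _ _).
Qed.

End SmoothMaps.

(** * Smooth maps and the symmetry of second derivatives *)

Section SmoothCalculus.
Context {R : realType}.
Implicit Types V W X Z : tvsType R.

Lemma smooth_sub V W (U U' : set V) (f : V -> W) : U' `<=` U ->
  smooth_on U f -> smooth_on U' f.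
Proof. by move=> UU' Sf n; exact: Cn_sub UU' (Sf n). Qed.

Lemma smooth_eq V W (U : set V) (f g : V -> W) : open U ->
  (forall x, U x -> f x = g x) -> smooth_on U f -> smooth_on U g.
Proof. by move=> oU fg Sf n; exact: Cn_eq fg (Sf n). Qed.

Lemma smooth_linear V W (L : V -> W) U : linear_map L -> continuous L ->
  smooth_on U L.
Proof. by move=> lL cL n; exact: Cn_linear. Qed.

Lemma smooth_id V (U : set V) : smooth_on U id.
Proof. by apply: smooth_linear => // x; exact: cvg_id. Qed.

Lemma smooth_fst V W (U : set (V * W)) : smooth_on U fst.
Proof. by apply: smooth_linear => //; exact: continuous_fst. Qed.

Lemma smooth_snd V W (U : set (V * W)) : smooth_on U snd.
Proof. by apply: smooth_linear => //; exact: continuous_snd. Qed.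

Lemma smooth_cst V W (c : W) (U : set V) : smooth_on U (fun=> c).
Proof. by move=> n; exact: Cn_cst. Qed.

Lemma smooth_pair V W X (U : set V) (f : V -> W) (g : V -> X) :
  smooth_on U f -> smooth_on U g -> smooth_on U (fun x => (f x, g x)).
Proof. by move=> Sf Sg n; exact: Cn_pair. Qed.

Lemma smooth_comp V W X (U : set V) (U' : set W) (f : V -> W) (g : W -> X) :
  open U -> open U' -> (forall x, U x -> U' (f x)) ->
  smooth_on U f -> smooth_on U' g -> smooth_on U (fun x => g (f x)).
Proof. by move=> oU oU' UU' Sf Sg n; exact: Cn_comp oU oU' UU' (Sf n) (Sg n). Qed.

Lemma smooth_bilinear V W X Z (b : V -> W -> X) (U : set Z) f g :
  bilinear_map b -> continuous (fun p : V * W => b p.1 p.2) -> open U ->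
  smooth_on U f -> smooth_on U g -> smooth_on U (fun x => b (f x) (g x)).
Proof.
move=> bb cb oU Sf Sg n.
apply: (@Cn_comp _ _ _ _ _ U setT (fun x => (f x, g x)) (fun p => b p.1 p.2)) => //.
- exact: openT.
- exact: Cn_pair.
- exact: Cn_bilinear.
Qed.

Lemma smooth_scale V W (U : set V) (f : V -> R^o) (g : V -> W) :
  open U -> smooth_on U f -> smooth_on U g -> smooth_on U (fun x => f x *: g x).
Proof.
move=> oU Sf Sg.
apply: (@smooth_bilinear R^o W W V (fun (r : R^o) (x : W) => r *: x) U f g) => //.
- split=> x r y z; first by rewrite scalerDr !scalerA [x * r]mulrC.
  by rewrite scalerDl scalerA.
- exact: scale_continuous.
Qed.

Lemma smooth_add V W (U : set V) (f g : V -> W) : open U ->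
  smooth_on U f -> smooth_on U g -> smooth_on U (fun x => f x + g x).
Proof. by move=> oU Sf Sg n; exact: Cn_add. Qed.

Lemma smooth_cont V W (U : set V) (f : V -> W) x : smooth_on U f -> U x ->
  {for x, continuous f}.
Proof. by move=> Sf; exact: Cn_cont (Sf 0%N). Qed.

Lemma smooth_plane V (x v w : V) (U : set (R^o * R^o)) : open U ->
  smooth_on U (fun q : R^o * R^o => x + q.1 *: v + q.2 *: w).
Proof.
move=> oU; suff H : smooth_on setT (fun q : R^o * R^o => x + q.1 *: v + q.2 *: w).
  exact: smooth_sub H.
have oT := @openT (R^o * R^o)%type.
apply: smooth_add => //; first apply: smooth_add => //; first exact: smooth_cst.
  apply: smooth_linear; first by move=> a y z; rewrite scalerDl scalerA.
  exact: continuous_compT (@continuous_fst _ _ _) (@continuous_scalel _ V v).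
apply: smooth_linear; first by move=> a y z; rewrite scalerDl scalerA.
exact: continuous_compT (@continuous_snd _ _ _) (@continuous_scalel _ V w).
Qed.

(** A fixed choice of the derivative. [Cn] only asserts that some derivative
   exists at each order; in a Hausdorff space all of them agree with this one,
   which is therefore smooth when [f] is. *)
Definition D V W (f : V -> W) (p : V * V) : W :=
  velocity (fun s => f (p.1 + s *: p.2)) 0.

Lemma has_dirderiv_D V W (f : V -> W) x v d : hausdorff_space W ->
  has_dirderiv f x v d -> D f (x, v) = d.
Proof. by move=> hW /has_dirderiv_line0 fd; exact: velocityP. Qed.

Lemma smooth_D V W (U : set V) (f : V -> W) : hausdorff_space W -> open U ->
  smooth_on U f -> C1 U f (D f) /\ smooth_on (U `*` setT) (D f).
Proof.
move=> hW oU Sf.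
have dE df : C1 U f df -> forall p, (U `*` setT) p -> df p = D f p.
  by move=> [_ fd _] [x v] [/= Ux _]; rewrite (has_dirderiv_D hW (fd x v Ux)).
have SD : smooth_on (U `*` setT) (D f).
  move=> n; have [df C1f Cdf] := Cn_C1 oU (Sf n.+1).
  by apply: Cn_eq Cdf; [exact: openXT|exact: dE].
split => //; have [df C1f _] := Cn_C1 oU (Sf 1%N); split => // x v Ux.
  by rewrite -(dE _ C1f) //; have [_ + _] := C1f; apply.
exact: (smooth_cont SD).
Qed.

Lemma smooth_chain V W (U : set V) (f : V -> W) (u : R -> V) t d :
  hausdorff_space W -> open U -> smooth_on U f -> U (u t) ->
  has_velocity u t d -> has_velocity (fun s => f (u s)) t (D f (u t, d)).
Proof. by move=> hW oU Sf Ut; apply: chain_velocity (smooth_D hW oU Sf).1 Ut. Qed.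

Lemma smooth_D_line V W (U : set V) (f : V -> W) x v : hausdorff_space W ->
  open U -> smooth_on U f -> U x ->
  has_velocity (fun s => f (x + s *: v)) 0 (D f (x, v)).
Proof.
move=> hW oU Sf Ux; apply/has_dirderiv_line0.
by have [[_ + _] _] := smooth_D hW oU Sf; apply.
Qed.

Lemma smooth_D_linear V W (U : set V) (f : V -> W) x : hausdorff_space W ->
  open U -> smooth_on U f -> U x -> linear_map (fun v => D f (x, v)).
Proof.
move=> hW oU Sf Ux a v w; have [C1f _] := smooth_D hW oU Sf.
by rewrite (C1_add _ _ hW C1f) // (C1_scale _ _ hW C1f).
Qed.

(** Derivatives found on different open sets agree, being all equal to [D f].
   *)
Lemma Cn_glue n V W (U : set V) (f : V -> W) : hausdorff_space W -> open U ->
  (forall x, U x -> exists O, [/\ open O, O x & smooth_on O f]) -> Cn n U f.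
Proof.
elim: n V U f => [|n IH] V U f hW oU Uf.
  by move=> x /set_mem /Uf [P [oP Px SP]]; exact: smooth_cont SP Px.
split; first by move=> x /set_mem /Uf [P [oP Px SP]]; exact: smooth_cont SP Px.
exists (D f); split.
  move=> x v /Uf [P [oP Px SP]]; apply/has_dirderiv_line0.
  exact: smooth_D_line SP Px.
apply: IH => //; first exact: openXT.
move=> [x v] [/= /Uf [P [oP Px SP]] _].
exists (P `*` setT); split => //; first exact: openXT.
by have [] := smooth_D hW oP SP.
Qed.

Lemma smooth_glue V W (U : set V) (f : V -> W) : hausdorff_space W -> open U ->
  (forall x, U x -> exists O, [/\ open O, O x & smooth_on O f]) -> smooth_on U f.
Proof. by move=> hW oU Uf n; exact: Cn_glue. Qed.

Lemma smooth_D_at V W (U : set V) (f : V -> W) v : hausdorff_space W -> open U ->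
  smooth_on U f -> smooth_on U (fun y => D f (y, v)).
Proof.
move=> hW oU Sf; have [_ SD] := smooth_D hW oU Sf.
apply: (@smooth_comp _ _ _ U (U `*` setT) (fun y => (y, v)) (D f)) => //.
- exact: openXT.
- by apply: smooth_pair; [exact: smooth_id|exact: smooth_cst].
Qed.

(** Two applications of [mean_value], along [v] and then along [w]: the second
   difference is [t ^+ 2] times an element of any convex neighbourhood of the
   mixed derivative. *)
Lemma second_difference V W (U : set V) (f : V -> W) x v w (C : set W) :
  hausdorff_space W -> open U -> smooth_on U f -> U x ->
  open C -> convex C -> C (D (fun y => D f (y, v)) (x, w)) ->
  exists2 e : R, 0 < e & forall t, 0 < t < e ->
    C (t^-1 *: (t^-1 *: (f (x + t *: v + t *: w) - f (x + t *: v)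
                 - (f (x + t *: w) - f x)))).
Proof.
move=> hW oU Sf Ux oC cC CL.
set g := fun y => D f (y, v).
have Sg : smooth_on U g by exact: smooth_D_at.
have Sgw := smooth_D_at w hW oU Sg.
have cont : continuous (fun q : R^o * R^o => x + q.1 *: v + q.2 *: w).
  move=> q; apply: cvgD_tvs; first apply: cvgD_tvs; first exact: cvg_cst.
    by apply: cvgZ_tvs; [exact: continuous_fst|exact: cvg_cst].
  by apply: cvgZ_tvs; [exact: continuous_snd|exact: cvg_cst].
have /(cont (0, 0)) : nbhs (x + 0 *: v + 0 *: w)
    [set y | U y /\ C (D g (y, w))].
  rewrite !scale0r !addr0; apply: filterI; first exact: open_nbhs_nbhs.
  by apply: (smooth_cont Sgw Ux); exact: open_nbhs_nbhs.
move=> [[P Q] /= [[d /= d0 Pd] [e /= e0 Qe]] PQ].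
exists (Num.min d e); first by rewrite lt_min d0.
move=> t /andP[t0]; rewrite lt_min => /andP[td te].
have near r s : 0 <= r <= t -> 0 <= s <= t ->
    U (x + r *: v + s *: w) /\ C (D g (x + r *: v + s *: w, w)).
  move=> /andP[r0 rt] /andP[s0 st]; apply: (PQ (r, s)); split.
    by apply: Pd; rewrite /= sub0r normrN ger0_norm //; lra.
  by apply: Qe; rewrite /= sub0r normrN ger0_norm //; lra.
pose phi r := t^-1 *: (f (x + r *: v + t *: w) - f (x + r *: v)).
suff : C (slope phi 0 t).
  by rewrite /slope /phi subr0 -scalerBr scale0r addr0.
apply: mean_value => // r rt.
exists (slope (fun s => g (x + r *: v + s *: w)) 0 t).
  apply: mean_value => // s st; exists (D g (x + r *: v + s *: w, w)).
    by have [] := near r s rt st.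
  apply/has_dirderiv_line/has_dirderiv_line0; apply: smooth_D_line Sg _ => //.
  by have [] := near r s rt st.
rewrite /slope subr0 scale0r addr0; apply: has_velocityZ.
have Hf s : 0 <= s <= t ->
    has_velocity (fun r => f (x + r *: v + s *: w)) r (g (x + r *: v + s *: w)).
  move=> st; have [Us _] := near r s rt st.
  have : has_velocity (fun r => f (x + s *: w + r *: v)) r (g (x + s *: w + r *: v)).
    apply/has_dirderiv_line/has_dirderiv_line0; apply: smooth_D_line Sf _ => //.
    by rewrite addrAC.
  by rewrite addrAC; under eq_fun do rewrite addrAC.
have H0 : has_velocity (fun r => f (x + r *: v)) r (g (x + r *: v)).
  have := Hf 0; rewrite scale0r addr0; under eq_fun do rewrite addr0.
  by apply; lra.
have Ht : has_velocity (fun r => f (x + r *: v + t *: w)) r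
    (g (x + r *: v + t *: w)) by apply: Hf; lra.
have := has_velocityD Ht (has_velocityZ (a := -1) H0).
by rewrite scaleN1r; under eq_fun do rewrite scaleN1r.
Qed.

(** The second difference of [second_difference] is symmetric in [v] and [w],
   while its quotient by [t ^+ 2] is close to both mixed derivatives. *)
Theorem schwarz V W (U : set V) (f : V -> W) x v w : hausdorff_space W ->
  open U -> smooth_on U f -> U x ->
  D (fun y => D f (y, v)) (x, w) = D (fun y => D f (y, w)) (x, v).
Proof.
move=> hW oU Sf Ux.
apply: (hW) => A B /nbhs_convex [C [oC Cx CA cC]] /nbhs_convex [C' [oC' Cx' CB cC']].
have [d d0 Hd] := second_difference hW oU Sf Ux oC cC Cx.
have [e e0 He] := second_difference hW oU Sf Ux oC' cC' Cx'.
pose t := Num.min d e / 2.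
have [td te t0] : [/\ t < d, t < e & 0 < t].
  by rewrite /t; case: (leP d e) => ?; split; lra.
have /Hd/CA At : 0 < t < d by rewrite t0.
have /He/CB Bt : 0 < t < e by rewrite t0.
exists (t^-1 *: (t^-1 *: (f (x + t *: v + t *: w) - f (x + t *: v)
                 - (f (x + t *: w) - f x)))); split => //.
suff <- : f (x + t *: w + t *: v) - f (x + t *: w) - (f (x + t *: v) - f x)
  = f (x + t *: v + t *: w) - f (x + t *: v) - (f (x + t *: w) - f x) by [].
rewrite [x + t *: w + t *: v]addrAC !opprB -!addrA; congr (_ + _).
by rewrite addrCA [RHS]addrCA; congr (_ + _); rewrite addrC.
Qed.

End SmoothCalculus.

(** * Smooth maps into a Lie group *)

Lemma open_preimage (T T' : topologicalType) (U : set T) (W : set T')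
    (f : T -> T') : open U -> open W -> (forall x, U x -> {for x, continuous f}) ->
  open (U `&` f @^-1` W).
Proof.
move=> oU oW cf; rewrite openE => x [Ux Wfx]; apply: filterI.
  exact: open_nbhs_nbhs.
by apply: (cf x Ux); exact: open_nbhs_nbhs.
Qed.

Section SmoothInto.
Context {R : realType} {E : tvsType R} {G : groupType} (S : lie_structure E G).
Implicit Types V W : tvsType R.

Local Notation smoothG := (smooth_into (atlas S)).

Lemma cranP (c : chart E G) x : cran c x -> cdom c (cinv c x) /\ c (cinv c x) = x.
Proof. by move=> [g dg <-]; rewrite cmapK. Qed.

(** The chart given by [smooth_into] can be exchanged for any other chart
   around the value, since changes of charts are smooth. *)
Lemma smoothG_chart V (U : set V) (f : V -> G) x d : smoothG U f -> U x ->
  atlas S d -> cdom d (f x) -> exists P, [/\ open P, P x, P `<=` U,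
    forall y, P y -> cdom d (f y) & smooth_on P (fun y => d (f y))].
Proof.
move=> Sf Ux ad dfx; have [c ac [P [oP Px PU Pc Sc]]] := Sf x Ux.
have [oW ST] := atlas_compat ac ad.
set W := c @` _ in oW ST.
have oQ : open (P `&` (fun y => c (f y)) @^-1` W).
  by apply: open_preimage => // y; exact: smooth_cont.
have Qd y : (P `&` (fun y => c (f y)) @^-1` W) y -> cdom d (f y).
  move=> [Py [g [cg dg] cgfy]]; suff -> : f y = g by [].
  by rewrite -(cmapK cg) cgfy cmapK //; exact: Pc.
exists (P `&` (fun y => c (f y)) @^-1` W); split => //.
- by split => //; exists (f x) => //; split => //; exact: Pc.
- by move=> y [/PU].
- apply: (@smooth_eq _ _ _ _ (fun y => d (cinv c (c (f y))))) => //.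
    by move=> y [Py _]; rewrite cmapK //; exact: Pc.
  apply: (@smooth_comp _ _ _ _ _ W (fun y => c (f y)) (fun z => d (cinv c z))) => //.
    by move=> y [].
  by apply: smooth_sub Sc => y [].
Qed.

Lemma smoothG_eq V (U : set V) (f g : V -> G) : (forall x, U x -> f x = g x) ->
  smoothG U f -> smoothG U g.
Proof.
move=> fg Sf x Ux; have [c ac [P [oP Px PU Pc Sc]]] := Sf x Ux.
exists c => //; exists P; split => //; first by move=> y Py; rewrite -fg; auto.
by apply: smooth_eq Sc => // y Py; rewrite -fg; auto.
Qed.

Lemma smoothG_cst V (U : set V) g : open U -> smoothG U (fun=> g).
Proof.
move=> oU x Ux; have [c ac cg] := atlas_cover S g.
by exists c => //; exists U; split => //; exact: smooth_cst.
Qed.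

Lemma smoothG_cinv c : atlas S c -> smoothG (cran c) (cinv c).
Proof.
move=> ac x cx; exists c => //; exists (cran c); split => //.
- exact: cran_open.
- by move=> y /cranP [].
- apply: (@smooth_eq _ _ _ _ id); first exact: cran_open.
    by move=> y /cranP [].
  exact: smooth_id.
Qed.

Lemma smoothG_comp V W (U : set V) (U' : set W) (u : V -> W) (f : W -> G) :
  open U -> (forall x, U x -> U' (u x)) -> smooth_on U u -> smoothG U' f ->
  smoothG U (fun x => f (u x)).
Proof.
move=> oU UU' Su Sf x Ux; have [c ac [P [oP Px PU Pc Sc]]] := Sf _ (UU' x Ux).
have oQ : open (U `&` u @^-1` P).
  by apply: open_preimage => // y; exact: smooth_cont.
exists c => //; exists (U `&` u @^-1` P); split => //.
- by move=> y [_ /Pc].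
- apply: smooth_comp Sc => //; first by move=> y [].
  by apply: smooth_sub Su => y [].
Qed.

Lemma smoothG_mul V (U : set V) (f g : V -> G) :
  smoothG U f -> smoothG U g -> smoothG U (fun x => f x * g x)%g.
Proof.
move=> Sf Sg x Ux; have [c ac [P [oP Px PU Pc Sc]]] := Sf x Ux.
have [d ad [Q [oQ Qx QU Qd Sd]]] := Sg x Ux.
have oPQ : open (P `&` Q) by exact: openI.
have : smoothG (P `&` Q) (fun x => f x * g x)%g.
  apply: (@smoothG_eq _ _ (fun y => cinv c (c (f y)) * cinv d (d (g y)))%g).
    by move=> y [/Pc fy /Qd gy]; rewrite !cmapK.
  apply: (@smoothG_comp _ _ _ _ (fun y => (c (f y), d (g y))) _ oPQ _ _
    (mul_smooth ac ad)).
    by move=> y [/Pc fy /Qd gy]; split; [exists (f y)|exists (g y)].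
  apply: smooth_pair; first by apply: smooth_sub Sc => y [].
  by apply: smooth_sub Sd => y [].
move=> /(_ x (conj Px Qx)) [e ae [T [oT Tx TU Te Se]]].
by exists e => //; exists T; split => // y /TU [/PU].
Qed.

Lemma smoothG_inv V (U : set V) (f : V -> G) :
  smoothG U f -> smoothG U (fun x => (f x)^-1)%g.
Proof.
move=> Sf x Ux; have [c ac [P [oP Px PU Pc Sc]]] := Sf x Ux.
have : smoothG P (fun x => (f x)^-1)%g.
  apply: (@smoothG_eq _ _ (fun y => (cinv c (c (f y)))^-1)%g).
    by move=> y /Pc fy; rewrite !cmapK.
  apply: (@smoothG_comp _ _ _ _ (fun y => c (f y)) _ oP _ Sc (inv_smooth ac)).
  by move=> y /Pc fy; exists (f y).
move=> /(_ x Px) [e ae [T [oT Tx TU Te Se]]].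
by exists e => //; exists T; split => // y /TU /PU.
Qed.

Let hE : hausdorff_space E := model_hausdorff S.
Local Notation log := (chart1 S).

(** Tangent vectors at the identity, read in the chart which identifies [E]
   with the Lie algebra. Only the behaviour at [0] matters, and the vector is
   determined by the germ of the curve; the identities between adjoint
   actions, brackets and right velocities are proved by computing the vector
   of one curve in two ways. *)
Definition tangent1 (g : R -> G) (X : E) : Prop :=
  [/\ g 0 = 1%g, \forall s \near (0 : R), cdom log (g s) &
      has_velocity (fun s => log (g s)) 0 X].

Lemma tangent1_unique g X Y : tangent1 g X -> tangent1 g Y -> X = Y.
Proof. by move=> [_ _ gX] [_ _ gY]; exact: has_velocity_unique gX gY. Qed.

Lemma tangent1_velocity g X : tangent1 g X -> velocity (fun s => log (g s)) 0 = X.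
Proof. by move=> [_ _ gX]; exact: velocityP. Qed.

Lemma tangent1_near (g g' : R -> G) X : (\forall s \near (0 : R), g s = g' s) ->
  tangent1 g X -> tangent1 g' X.
Proof.
move=> gg' [g0 gd gX]; split.
- by rewrite -(nbhs_singleton gg').
- near=> s; have <- : g s = g' s by near: s.
  by near: s.
- by apply: has_velocity_near gX; apply: filterS gg' => s ->.
Unshelve. all: by end_near. Qed.

Lemma log_cran0 : cran log 0.
Proof. by exists 1%g; [exact: chart1_dom|exact: chart1_center]. Qed.

Lemma cinv_log0 : cinv log 0 = 1%g.
Proof. by rewrite -(chart1_center S) cmapK //; exact: chart1_dom. Qed.

(** The chain rule for a curve which passes through the identity. *)
Lemma tangent1_smoothG V (U : set V) (F : V -> G) (u : R -> V) d :
  smoothG U F -> U (u 0) -> F (u 0) = 1%g -> has_velocity u 0 d ->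
  tangent1 (fun s => F (u s)) (D (fun y => log (F y)) (u 0, d)).
Proof.
move=> SF U0 F0 ud.
have [|P [oP Px PU Pd SP]] := smoothG_chart SF U0 (chart1_atlas S).
  by rewrite F0; exact: chart1_dom.
split => //.
  have u0 : u @ (0 : R) --> u 0 by exact: has_velocity_cont ud.
  have nP : \forall s \near (0 : R), P (u s).
    exact: u0 (open_nbhs_nbhs (conj oP Px)).
  by apply: filterS nP => s /Pd.
exact: smooth_chain SP Px ud.
Qed.

End SmoothInto.

(** * The adjoint action *)

Section AdjointAction.
Context {R : realType} {E : tvsType R} {G : groupType} (S : lie_structure E G).
Implicit Types V W : tvsType R.

Let hE : hausdorff_space E := model_hausdorff S.
Local Notation smoothG := (smooth_into (atlas S)).
Local Notation log := (chart1 S).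
Local Notation tangent1 := (tangent1 S).

Let a1 : atlas S log := chart1_atlas S.

Lemma tangent1_cst : tangent1 (fun=> 1%g) 0.
Proof.
split => //; last exact: has_velocity_cst.
  by apply: filterE => _; exact: chart1_dom.
Qed.

Lemma tangent1_log0 g X : tangent1 g X -> log (g 0) = 0.
Proof. by move=> [-> _ _]; exact: chart1_center. Qed.

Lemma tangent1_affine g X a : tangent1 g X -> tangent1 (fun s => g (a * s)) (a *: X).
Proof.
move=> [g0 gd gX].
have H : has_velocity (fun s => log (g s)) (0 + a * 0) X by rewrite mulr0 addr0.
have c0 : (fun s : R => a * s) @ (0 : R) --> (a * 0 : R).
  exact: mulrl_continuous.
rewrite mulr0 in c0.
split; first by rewrite mulr0.
  exact: c0 gd.
by have := has_velocity_affine H; under eq_fun do rewrite add0r.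
Qed.

Lemma tangent1_log V (U : set V) (F : V -> G) (L : E -> V) g X :
  linear_map L -> continuous L -> smoothG U F -> U 0 -> F 0 = 1%g ->
  tangent1 g X ->
  tangent1 (fun s => F (L (log (g s)))) (D (fun y => log (F y)) (0, L X)).
Proof.
move=> lL cL SF U0 F0 gX; have g0 := tangent1_log0 gX.
have := @tangent1_smoothG _ _ _ S V U F (fun s => L (log (g s))) (L X) SF.
rewrite g0 linear_map0 //; apply => //.
by apply: has_velocity_linear => //; case: gX.
Qed.

Lemma tangent1_cinv g X : tangent1 g X ->
  \forall s \near (0 : R), cinv log (log (g s)) = g s.
Proof. by move=> [_ gd _]; apply: filterS gd => s; exact: cmapK. Qed.

Lemma tangent1_ray X : tangent1 (ray S X) X.
Proof.
have S0 : smoothG (cran log) (cinv log) by exact: smoothG_cinv.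
have XX : has_velocity (fun s => s *: X) 0 X.
  by have := @has_velocity_line _ _ 0 X 0; under eq_fun do rewrite add0r.
have := tangent1_smoothG (u := fun s => s *: X) (d := X) S0.
rewrite scale0r cinv_log0 => /(_ (log_cran0 S) erefl XX) T1.
suff E0 : D (fun y => log (cinv log y)) (0, X) = X by rewrite E0 in T1.
have [_ _ T1'] := T1; apply: (has_velocity_unique hE T1').
have oc : open (cran log) by exact: cran_open.
apply: has_velocity_near XX.
have c0 : (fun s => s *: X) @ (0 : R) --> (0 *: X : E).
  by apply: cvgZ_tvs; [exact: cvg_id|exact: cvg_cst].
rewrite scale0r in c0.
have nc : \forall s \near (0 : R), cran log (s *: X).
  exact: c0 (open_nbhs_nbhs (conj oc (log_cran0 S))).
by apply: filterS nc => s /cranP [_ ->].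
Qed.

(** In the chart, the multiplication is smooth and restricts to the identity
   on both axes, so that its derivative at the origin is the addition. *)
Lemma tangent1_mul g h X Y : tangent1 g X -> tangent1 h Y ->
  tangent1 (fun s => g s * h s)%g (X + Y).
Proof.
move=> gX hY; have [g0 _ gX'] := gX; have [h0 _ hY'] := hY.
pose F (p : E * E) := (cinv log p.1 * cinv log p.2)%g.
have SF : smoothG (cran log `*` cran log) F by apply: mul_smooth.
have F0 : F 0 = 1%g by rewrite /F /= !cinv_log0 mulg1.
have c0 := log_cran0 S.
have [|P [oP P0 _ Pd SP]] := smoothG_chart SF (conj c0 c0 : _ (0 : E * E)) a1.
  by rewrite F0; exact: chart1_dom.
have lD := smooth_D_linear hE oP SP P0.
have DX Z : D (fun y => log (F y)) (0, (Z, 0)) = Z.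
  have := @tangent1_log _ _ F (fun x => (x, 0)) _ Z _ _ SF (conj c0 c0) F0
     (tangent1_ray Z).
  move=> /(_ _ _)/tangent1_unique; apply.
  - by move=> a x y; congr pair; rewrite /= scaler0 addr0.
  - by move=> x; apply: cvg_pair; [exact: cvg_id|exact: cvg_cst].
  apply: tangent1_near (tangent1_ray Z); apply: filterS (tangent1_cinv (tangent1_ray Z)).
  by move=> s E0; rewrite /F /= E0 cinv_log0 mulg1.
have DY Z : D (fun y => log (F y)) (0, (0, Z)) = Z.
  have := @tangent1_log _ _ F (fun x => (0, x)) _ Z _ _ SF (conj c0 c0) F0
     (tangent1_ray Z).
  move=> /(_ _ _)/tangent1_unique; apply.
  - by move=> a x y; congr pair; rewrite /= scaler0 addr0.
  - by move=> x; apply: cvg_pair; [exact: cvg_cst|exact: cvg_id].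
  apply: tangent1_near (tangent1_ray Z); apply: filterS (tangent1_cinv (tangent1_ray Z)).
  by move=> s E0; rewrite /F /= E0 cinv_log0 mul1g.
have := tangent1_smoothG (u := fun s => (log (g s), log (h s))) (d := (X, Y)) SF.
rewrite (tangent1_log0 gX) (tangent1_log0 hY).
move=> /(_ (conj c0 c0) F0 (has_velocity_pair gX' hY')).
have -> : (X, Y) = (X, 0) + (0, Y) by congr pair; rewrite /= ?addr0 ?add0r.
rewrite (linear_mapD _ _ lD) DX DY; apply: tangent1_near.
apply: filterS2 (tangent1_cinv gX) (tangent1_cinv hY) => s E1 E2.
by rewrite /F /= E1 E2.
Qed.

Lemma conj_smoothG a : smoothG (cran log) (fun x => a * cinv log x * a^-1)%g.
Proof.
have oc : open (cran log) by exact: cran_open.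
apply: smoothG_mul; last exact: smoothG_cst.
by apply: smoothG_mul; [exact: smoothG_cst|exact: smoothG_cinv].
Qed.

Lemma conj_cinv0 a : (a * cinv log 0 * a^-1)%g = 1%g.
Proof. by rewrite cinv_log0 mulg1 mulgV. Qed.

Lemma AdE a X : Ad S a X = D (fun x => log (a * cinv log x * a^-1)%g) (0, X).
Proof.
by apply: eq_velocity => s; rewrite /ray /= add0r.
Qed.

Lemma Ad_chart a : exists P : set E, [/\ open P, P 0 &
  smooth_on P (fun x => log (a * cinv log x * a^-1)%g)].
Proof.
have [|P [oP P0 _ _ SP]] := smoothG_chart (conj_smoothG a) (log_cran0 S) a1.
  by rewrite conj_cinv0; exact: chart1_dom.
by exists P.
Qed.

Lemma Ad_linear a : linear_map (Ad S a).
Proof.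
have [P [oP P0 SP]] := Ad_chart a.
by move=> r X Y; rewrite !AdE (smooth_D_linear hE oP SP P0).
Qed.

Lemma Ad_continuous a : continuous (Ad S a).
Proof.
have [P [oP P0 SP]] := Ad_chart a; have [_ SD] := smooth_D hE oP SP.
have -> : Ad S a = D (fun x => log (a * cinv log x * a^-1)%g) \o pair 0.
  by apply/funext => Y; rewrite AdE.
move=> X; apply: continuous_comp.
  by apply: cvg_pair; [exact: cvg_cst|exact: cvg_id].
exact: (smooth_cont SD (conj P0 I : (P `*` setT) (0, X))).
Qed.

Lemma tangent1_conj a g X : tangent1 g X ->
  tangent1 (fun s => a * g s * a^-1)%g (Ad S a X).
Proof.
move=> gX; have [_ _ gX'] := gX.
have := tangent1_smoothG (u := fun s => log (g s)) (d := X) (conj_smoothG a).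
rewrite (tangent1_log0 gX) -AdE => /(_ (log_cran0 S) (conj_cinv0 a) gX').
by apply: tangent1_near; apply: filterS (tangent1_cinv gX) => s ->.
Qed.

Lemma Ad1 X : Ad S 1%g X = X.
Proof.
apply: tangent1_unique (tangent1_conj 1%g (tangent1_ray X)) _.
by under eq_fun do rewrite invg1 mulg1 mul1g; exact: tangent1_ray.
Qed.

(** Both sides are the tangent vector of the same curve. *)
Lemma AdM a b X : Ad S (a * b)%g X = Ad S a (Ad S b X).
Proof.
apply: tangent1_unique (tangent1_conj _ (tangent1_ray X)) _.
have := tangent1_conj a (tangent1_conj b (tangent1_ray X)).
by apply: tangent1_near; apply: filterE => s; rewrite invgM !mulgA.
Qed.

Lemma AdK a X : Ad S a^-1%g (Ad S a X) = X.
Proof. by rewrite -AdM mulVg Ad1. Qed.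

Lemma AdKV a X : Ad S a (Ad S a^-1%g X) = X.
Proof. by rewrite -AdM mulgV Ad1. Qed.

(** [Ad] is a partial derivative of [(x, y) |-> x y x^-1], read in the chart.
   *)
Lemma smooth_Ad : exists P : set E, [/\ open P, P 0 &
  smooth_on (P `*` setT) (fun p => Ad S (cinv log p.1) p.2)].
Proof.
pose F (p : E * E) := (cinv log p.1 * cinv log p.2 * (cinv log p.1)^-1)%g.
have oc : open (cran log) by exact: cran_open.
have oc2 : open (cran log `*` cran log) by exact: openX.
have S1 : smoothG (cran log `*` cran log) (fun p : E * E => cinv log p.1).
  apply: (smoothG_comp (U' := cran log) (f := cinv log)) => //.
  - by move=> p [].
  - exact: smooth_fst.
  - exact: smoothG_cinv.
have S2 : smoothG (cran log `*` cran log) (fun p : E * E => cinv log p.2).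
  apply: (smoothG_comp (U' := cran log) (f := cinv log)) => //.
  - by move=> p [].
  - exact: smooth_snd.
  - exact: smoothG_cinv.
have SF : smoothG (cran log `*` cran log) F.
  by apply: smoothG_mul; [exact: smoothG_mul|exact: smoothG_inv].
have c0 := log_cran0 S.
have [|P [oP P0 _ Pd SP]] := smoothG_chart SF (conj c0 c0 : _ (0, 0)) a1.
  by rewrite /F /= !cinv_log0 !mul1g invg1; exact: chart1_dom.
have cx : continuous (fun x : E => (x, 0 : E)).
  by move=> x; apply: cvg_pair; [exact: cvg_id|exact: cvg_cst].
exists ((fun x => (x, 0)) @^-1` P); split => //.
  by apply: open_comp => // x _; exact: cx.
have oQ : open ((fun x => (x, 0)) @^-1` P).
  by apply: open_comp => // x _; exact: cx.
have [_ SD] := smooth_D hE oP SP.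
apply: (@smooth_eq _ _ _ _ (fun p => D (fun q => log (F q)) ((p.1, 0), (0, p.2)))).
- exact: openXT.
- move=> [x Y] [/= Px _]; apply: eq_velocity => s.
  by rewrite /ray /F /= scaler0 addr0 add0r.
- apply: (@smooth_comp _ _ _ _ _ (P `*` setT) (fun p : E * E => ((p.1, 0), (0, p.2)))
    (D (fun q => log (F q)))) => //.
  + by apply: openXT.
  + by apply: openXT.
  + apply: smooth_pair; apply: smooth_pair; try exact: smooth_cst.
      exact: smooth_fst.
    exact: smooth_snd.
Qed.

End AdjointAction.

(** * The bracket and the Maurer-Cartan equation *)

Section Bracket.
Context {R : realType} {E : tvsType R} {G : groupType} (S : lie_structure E G).
Implicit Types V W : tvsType R.

Let hE : hausdorff_space E := model_hausdorff S.
Local Notation smoothG := (smooth_into (atlas S)).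
Local Notation log := (chart1 S).
Local Notation tangent1 := (tangent1 S).
Local Notation bracket := (bracket S).
Local Notation Ad := (Ad S).

(** Since [Ad] is smooth in both variables, the bracket inherits its
   continuity and its linearity in the first variable from the derivative. *)
Lemma bracketE X Y : bracket X Y =
  D (fun p : E * E => Ad (cinv log p.1) p.2) ((0, Y), (X, 0)).
Proof.
by apply: eq_velocity => s /=; rewrite scaler0 addr0 add0r.
Qed.

Lemma has_velocity_Ad g X u d : tangent1 g X -> has_velocity u 0 d ->
  has_velocity (fun t => Ad (g t) (u t)) 0 (bracket X (u 0) + d).
Proof.
move=> gX ud; have [_ _ gX'] := gX; have [P [oP P0 SA]] := smooth_Ad S.
have oPT : open (P `*` [set: E]) by exact: openXT.
have P0u : (P `*` [set: E]) (0, u 0) by [].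
have := smooth_chain (u := fun t => (log (g t), u t)) (t := 0) (d := (X, d)) hE oPT SA.
rewrite (tangent1_log0 gX) => /(_ P0u (has_velocity_pair gX' ud)) H.
have {H} : has_velocity (fun t => Ad (g t) (u t)) 0
    (D (fun p : E * E => Ad (cinv log p.1) p.2) ((0, u 0), (X, d))).
  by apply: has_velocity_near H; apply: filterS (tangent1_cinv gX) => s ->.
have -> : (X, d) = (X, 0) + (0, d) by congr pair; rewrite /= ?addr0 ?add0r.
rewrite (linear_mapD _ _ (smooth_D_linear hE oPT SA P0u)) -bracketE.
suff -> : D (fun p : E * E => Ad (cinv log p.1) p.2) (0, u 0, (0, d)) = d by [].
apply: velocityP => //=; have := @has_velocity_line _ _ (u 0) d 0.
by move=> H'; apply: eq_has_velocity H' => s; rewrite scaler0 addr0 cinv_log0 Ad1.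
Qed.

Lemma has_velocity_Ad_cst g X Y : tangent1 g X ->
  has_velocity (fun t => Ad (g t) Y) 0 (bracket X Y).
Proof.
move=> gX; rewrite -[bracket X Y]addr0.
exact: has_velocity_Ad gX (has_velocity_cst Y 0).
Qed.

Lemma bracket_linear_l Y : linear_map (bracket ^~ Y).
Proof.
have [P [oP P0 SA]] := smooth_Ad S.
have oPT : open (P `*` [set: E]) by exact: openXT.
have P0u : (P `*` [set: E]) (0, Y) by [].
move=> a X Z; rewrite !bracketE -(smooth_D_linear hE oPT SA P0u).
by congr (D _ (_, _)); congr pair; rewrite /= scaler0 addr0.
Qed.

Lemma bracket_linear_r X : linear_map (bracket X).
Proof.
move=> a Y Z.
have H T : has_velocity (fun t => Ad (ray S X t) T) 0 (bracket X T).
  exact: has_velocity_Ad_cst (tangent1_ray S X).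
apply: (has_velocity_unique hE (H _)).
have := has_velocityD (has_velocityZ (a := a) (H Y)) (H Z).
by move=> H'; apply: eq_has_velocity H' => s; rewrite Ad_linear.
Qed.

Lemma bracket_continuous : continuous (fun p : E * E => bracket p.1 p.2).
Proof.
have [P [oP P0 SA]] := smooth_Ad S.
have oPT : open (P `*` [set: E]) by exact: openXT.
have [_ SD] := smooth_D hE oPT SA.
have -> : (fun p : E * E => bracket p.1 p.2) =
    D (fun p : E * E => Ad (cinv log p.1) p.2) \o
    (fun p : E * E => ((0, p.2), (p.1, 0))).
  by apply/funext => p; rewrite bracketE.
have c0 : continuous (fun p : E * E => (((0 : E), p.2), (p.1, (0 : E)))).
  apply: continuous_pairT; apply: continuous_pairT; try by move=> q; exact: cvg_cst.
    exact: continuous_snd.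
  exact: continuous_fst.
move=> p; apply: continuous_comp; first exact: c0.
by apply: (smooth_cont SD).
Qed.

(** Conjugation by [a] carries a curve with tangent vector [X] to one with
   tangent vector [Ad a X], and [Ad a] commutes with velocities. *)
Lemma Ad_bracket a X Y : Ad a (bracket X Y) = bracket (Ad a X) (Ad a Y).
Proof.
have rX := tangent1_ray S X.
have H1 := has_velocity_linear (@Ad_linear _ _ _ S a)
  (@Ad_continuous _ _ _ S a) (has_velocity_Ad_cst (Y := Y) rX).
apply: (has_velocity_unique hE H1).
have := has_velocity_Ad_cst (Y := Ad a Y) (tangent1_conj a rX).
by move=> H'; apply: eq_has_velocity H' => s; rewrite -!AdM mulgVK.
Qed.

(** The right logarithmic derivative [dF F^-1], the pull-back by [F] of the
   right-invariant Maurer-Cartan form. *)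
Definition rlog V (F : V -> G) (x v : V) : E :=
  D (fun y => log (F y * (F x)^-1)%g) (x, v).

Lemma rtrans_smoothG V (U : set V) (F : V -> G) a : open U -> smoothG U F ->
  smoothG U (fun y => F y * a)%g.
Proof. by move=> oU SF; apply: smoothG_mul => //; exact: smoothG_cst. Qed.

Lemma tangent1_rlog V (U : set V) (F : V -> G) (u : R -> V) d : open U ->
  smoothG U F -> U (u 0) -> has_velocity u 0 d ->
  tangent1 (fun s => F (u s) * (F (u 0))^-1)%g (rlog F (u 0) d).
Proof.
move=> oU SF U0 ud.
apply: tangent1_smoothG (rtrans_smoothG (F (u 0))^-1%g oU SF) U0 _ ud.
by rewrite mulgV.
Qed.

Lemma tangent1_rlog_line V (U : set V) (F : V -> G) x v : open U ->
  smoothG U F -> U x ->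
  tangent1 (fun s => F (x + s *: v) * (F x)^-1)%g (rlog F x v).
Proof.
move=> oU SF Ux.
have := tangent1_rlog (u := fun s => x + s *: v) (d := v) oU SF.
rewrite scale0r addr0; apply => //; exact: has_velocity_line.
Qed.

(** [rlog F] is a derivative of [(y, x) |-> F y (F x)^-1] along the diagonal.
   *)
Lemma rlog_smooth V (U : set V) (F : V -> G) : open U -> smoothG U F ->
  smooth_on (U `*` setT) (fun p => rlog F p.1 p.2).
Proof.
move=> oU SF; apply: smooth_glue => //; first exact: openXT.
move=> [x0 v0] [/= Ux0 _].
have oUU : open (U `*` U) by exact: openX.
pose H (p : V * V) := (F p.1 * (F p.2)^-1)%g.
have SH : smoothG (U `*` U) H.
  apply: smoothG_mul; last apply: smoothG_inv.
    apply: (smoothG_comp (U' := U) (f := F)) => //; first by move=> p [].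
    exact: smooth_fst.
  apply: (smoothG_comp (U' := U) (f := F)) => //; first by move=> p [].
  exact: smooth_snd.
have [|P [oP P0 _ Pd SP]] := smoothG_chart SH (conj Ux0 Ux0 : _ (x0, x0)) (chart1_atlas S).
  by rewrite /H /= mulgV; exact: chart1_dom.
have [_ SD] := smooth_D hE oP SP.
have oQ : open ((fun x => (x, x)) @^-1` P).
  apply: open_comp => // x _; apply: cvg_pair; exact: cvg_id.
exists ((fun x => (x, x)) @^-1` P `*` setT); split => //.
  exact: openXT.
apply: (@smooth_eq _ _ _ _ (fun p => D (fun q => log (H q)) ((p.1, p.1), (p.2, 0)))).
- exact: openXT.
- move=> [x v] [/= Px _]; apply: eq_velocity => s.
  by rewrite /H /= scaler0 addr0.
- apply: (@smooth_comp _ _ _ _ _ (P `*` setT) (fun p : V * V => ((p.1, p.1), (p.2, 0)))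
    (D (fun q => log (H q)))) => //.
  + by apply: openXT.
  + by apply: openXT.
  + apply: smooth_pair; apply: smooth_pair; try exact: smooth_cst.
    * exact: smooth_fst.
    * exact: smooth_fst.
    * exact: smooth_snd.
Qed.

Lemma rlog_smooth_at V (U : set V) (F : V -> G) v : open U -> smoothG U F ->
  smooth_on U (fun x => rlog F x v).
Proof.
move=> oU SF; have SR := rlog_smooth oU SF.
apply: (@smooth_comp _ _ _ _ U (U `*` setT) (fun x => (x, v))
  (fun p => rlog F p.1 p.2)) => //.
- by apply: openXT.
- by apply: smooth_pair; [exact: smooth_id|exact: smooth_cst].
Qed.

Lemma rvelE (g : R -> G) t : rvel S g t = @rlog R^o g t 1.
Proof.
rewrite /rvel /rlog /D /velocity /=; congr (xget 0 _).
by apply/seteqP; split => d /= H; apply: cvg_eqfun H _ => h;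
  rewrite !add0r scale0r addr0 /GRing.scale /= mulr1.
Qed.

(** Write [F (p + s *: v + t *: w) = g s * N (s, t) * h t * F p], where [g s =
   F (p + s *: v) (F p)^-1] and [h t = F (p + t *: w) (F p)^-1], so that [N]
   is [1] on both axes. With [X] and [Y] the vectors of [g] and [h], the right
   velocity in [t] along the first axis is [Ad (g s) (dN/dt + Y)], and the
   right velocity in [s] along the second axis is [X + dN/ds]. By [schwarz]
   the mixed derivatives of [N] agree, and what remains is the derivative of
   [Ad (g s) Y]. *)
Theorem maurer_cartan V (U : set V) (F : V -> G) (p v w : V) : open U ->
  smoothG U F -> U p ->
  D (fun x => rlog F x w) (p, v) =
  D (fun x => rlog F x v) (p, w) + bracket (rlog F p v) (rlog F p w).
Proof.
move=> oU SF Up.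
(* All three are affine in the pair of parameters, as [smooth_plane] expects. *)
pose st (q : R^o * R^o) := p + q.1 *: v + q.2 *: w.
pose s0 (q : R^o * R^o) := p + q.1 *: v + q.2 *: (0 : V).
pose t0 (q : R^o * R^o) := p + q.1 *: (0 : V) + q.2 *: w.
have oT := @openT (R^o * R^o)%type.
pose Q := [set q | U (s0 q)] `&` [set q | U (st q)] `&` [set q | U (t0 q)].
have oQ : open Q.
  apply: openI; first apply: openI.
  - by apply: (@open_comp _ _ s0) => // q _; exact: smooth_cont (smooth_plane _ _ _ oT) I.
  - by apply: (@open_comp _ _ st) => // q _; exact: smooth_cont (smooth_plane _ _ _ oT) I.
  - by apply: (@open_comp _ _ t0) => // q _; exact: smooth_cont (smooth_plane _ _ _ oT) I.
pose N q := (F p * (F (s0 q))^-1 * F (st q) * (F (t0 q))^-1)%g.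
have SN : smoothG Q N.
  apply: smoothG_mul; first apply: smoothG_mul; first apply: smoothG_mul.
  - exact: smoothG_cst.
  - apply: smoothG_inv; apply: (smoothG_comp (U' := U) (u := s0) (f := F)) => //.
      by move=> q [[]].
    exact: smooth_plane.
  - apply: (smoothG_comp (U' := U) (u := st) (f := F)) => //.
      by move=> q [[]].
    exact: smooth_plane.
  - apply: smoothG_inv; apply: (smoothG_comp (U' := U) (u := t0) (f := F)) => //.
      by move=> q [].
    exact: smooth_plane.
have s0E s t : s0 (s, t) = p + s *: v by rewrite /s0 scaler0 addr0.
have t0E s t : t0 (s, t) = p + t *: w by rewrite /t0 scaler0 addr0.
have stE s t : st (s, t) = p + s *: v + t *: w by [].
have N10 s : N (s, 0) = 1%g.
  by rewrite /N s0E t0E stE !scale0r !addr0 mulgVK mulgV.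
have N01 t : N (0, t) = 1%g.
  by rewrite /N s0E t0E stE !scale0r !addr0 mulgV mul1g mulgV.
have Q0 : Q (0, 0).
  by rewrite /Q /= s0E stE t0E !scale0r !addr0.
have [|P [oP P0 PQ Pd SP]] := smoothG_chart SN Q0 (chart1_atlas S).
  by rewrite N10; exact: chart1_dom.
pose n q := log (N q).
pose a s := D n ((s, 0), (0, 1)).
pose b t := D n ((0, t), (1, 0)).
pose X := rlog F p v; pose Y := rlog F p w.
pose g s := (F (p + s *: v) * (F p)^-1)%g.
pose h t := (F (p + t *: w) * (F p)^-1)%g.
have gX : tangent1 g X := tangent1_rlog_line v oU SF Up.
have hY : tangent1 h Y := tangent1_rlog_line w oU SF Up.
have Ta s : P (s, 0) -> tangent1 (fun t => N (s, t)) (a s).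
  move=> Ps; apply: (tangent1_smoothG (u := fun t => (s, t)) SN) => //.
    exact: PQ.
  by apply: has_velocity_pair; [exact: has_velocity_cst|exact: has_velocity_id].
have Tb t : P (0, t) -> tangent1 (fun s => N (s, t)) (b t).
  move=> Pt; apply: (tangent1_smoothG (u := fun s => (s, t)) SN) => //.
    exact: PQ.
  by apply: has_velocity_pair; [exact: has_velocity_id|exact: has_velocity_cst].
have a0 : a 0 = 0.
  apply: tangent1_unique (Ta 0 P0) _.
  by under eq_fun do rewrite N01; exact: tangent1_cst.
have Ua s : P (s, 0) -> U (p + s *: v).
  by move=> /PQ [[]]; rewrite /= s0E.
have Ub t : P (0, t) -> U (p + t *: w).
  by move=> /PQ [_]; rewrite /= t0E.
have rlog_s s : P (s, 0) -> rlog F (p + s *: v) w = Ad (g s) (a s + Y).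
  move=> Ps; apply: tangent1_unique (tangent1_rlog_line w oU SF (Ua s Ps)) _.
  have := tangent1_conj (g s) (tangent1_mul (Ta s Ps) hY).
  apply: tangent1_near; apply: filterE => t.
  by rewrite /N /g /h s0E t0E stE invgM invgK !mulgA !mulgVK mulgV mul1g.
have rlog_t t : P (0, t) -> rlog F (p + t *: w) v = X + b t.
  move=> Pt; apply: tangent1_unique (tangent1_rlog_line v oU SF (Ub t Pt)) _.
  have := tangent1_mul gX (Tb t Pt).
  apply: tangent1_near; apply: filterE => s.
  by rewrite /N /g /h s0E t0E stE !mulgA !mulgVK mulgV mul1g addrAC.
have Va : has_velocity a 0 (D (fun q => D n (q, (0, 1))) ((0, 0), (1, 0))).
  have := smooth_D_line (v := ((1, 0) : R^o * R^o)) hE oP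
    (smooth_D_at ((0, 1) : R^o * R^o) hE oP SP) P0.
  move=> H; apply: eq_has_velocity H => s; rewrite /a.
  suff -> : ((0, 0) : R^o * R^o) + s *: ((1, 0) : R^o * R^o) = (s, 0) by [].
  by congr pair; rewrite /= add0r /GRing.scale /= ?mulr1 ?mulr0.
have Vb : has_velocity b 0 (D (fun q => D n (q, (1, 0))) ((0, 0), (0, 1))).
  have := smooth_D_line (v := ((0, 1) : R^o * R^o)) hE oP
    (smooth_D_at ((1, 0) : R^o * R^o) hE oP SP) P0.
  move=> H; apply: eq_has_velocity H => s; rewrite /b.
  suff -> : ((0, 0) : R^o * R^o) + s *: ((0, 1) : R^o * R^o) = (0, s) by [].
  by congr pair; rewrite /= add0r /GRing.scale /= ?mulr1 ?mulr0.
have nP : nbhs ((0, 0) : R^o * R^o) P by exact: open_nbhs_nbhs.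
have nPs : \forall s \near (0 : R), P (s, 0).
  have c0 : (fun s : R^o => (s, 0 : R^o)) @ (0 : R^o) --> ((0, 0) : R^o * R^o).
    exact: (cvg_pair cvg_id (cvg_cst (0 : R^o))).
  exact: c0 nP.
have nPt : \forall t \near (0 : R), P (0, t).
  have c0 : (fun t : R^o => (0 : R^o, t)) @ (0 : R^o) --> ((0, 0) : R^o * R^o).
    exact: (cvg_pair (cvg_cst (0 : R^o)) cvg_id).
  exact: c0 nP.
have H1 := smooth_D_line (v := v) hE oU (rlog_smooth_at w oU SF) Up.
have H2 := smooth_D_line (v := w) hE oU (rlog_smooth_at v oU SF) Up.
have K1 : has_velocity (fun s => rlog F (p + s *: v) w) 0
    (bracket X (a 0 + Y) + (D (fun q => D n (q, (0, 1))) ((0, 0), (1, 0)) + 0)).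
  have := has_velocity_Ad gX (has_velocityD Va (has_velocity_cst Y 0)).
  apply: has_velocity_near; apply: filterS nPs => s Ps.
  by rewrite rlog_s.
have K2 : has_velocity (fun t => rlog F (p + t *: w) v) 0
    (0 + D (fun q => D n (q, (1, 0))) ((0, 0), (0, 1))).
  have := has_velocityD (has_velocity_cst X 0) Vb.
  apply: has_velocity_near; apply: filterS nPt => t Pt.
  by rewrite rlog_t.
rewrite (has_velocity_unique hE H1 K1) (has_velocity_unique hE H2 K2).
rewrite a0 [0 + Y]add0r [LHS]addrC [X in X + _]addr0 [X in _ = X + _]add0r.
by rewrite (schwarz _ _ hE oP SP P0).
Qed.

(** The Maurer-Cartan equation of the multiplication at the identity, where
   the right velocities along the axes are [X] and [Y], compared with the
   equation in which the axes are exchanged. *)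
Lemma bracketC X Y : bracket X Y = - bracket Y X.
Proof.
pose F (q : E * E) := (cinv log q.1 * cinv log q.2)%g.
have oc : open (cran log) by exact: cran_open.
have occ : open (cran log `*` cran log) by exact: openX.
have SF : smoothG (cran log `*` cran log) F.
  by apply: mul_smooth; exact: chart1_atlas.
have U0 : (cran log `*` cran log) (0, 0) by split; exact: log_cran0.
have rX : rlog F (0, 0) (X, 0) = X.
  apply: tangent1_unique (tangent1_rlog_line (X, 0) occ SF U0) _.
  have := tangent1_ray S X; apply: tangent1_near; apply: filterE => s.
  by rewrite /F /ray /= scaler0 !addr0 add0r cinv_log0 invgM invg1 !mulg1.
have rY : rlog F (0, 0) (0, Y) = Y.
  apply: tangent1_unique (tangent1_rlog_line (0, Y) occ SF U0) _.
  have := tangent1_ray S Y; apply: tangent1_near; apply: filterE => s.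
  by rewrite /F /ray /= scaler0 !addr0 add0r cinv_log0 invgM invg1 !mulg1 mul1g.
have := maurer_cartan (X, 0) (0, Y) occ SF U0.
have := maurer_cartan (0, Y) (X, 0) occ SF U0.
rewrite rX rY; set A := D _ _; set B := D _ _ => EB EA.
apply/eqP; rewrite -addr_eq0; apply/eqP; apply: (addrI A).
by rewrite addr0 addrA -EA -EB.
Qed.

End Bracket.

(** * Real-valued curves and symmetric intervals *)

Section RealVelocity.
Context {R : realType}.

Lemma is_derive_velocity (u : R -> R) (t d : R) :
  is_derive t 1 u d <-> @has_velocity R R^o u t d.
Proof.
have E : (fun h : R => h^-1 *: ((u \o shift t) (h *: (1 : R)) - u t)) =
    (fun h : R => h^-1 *: (u (t + h) - u t)).
  by apply/funext => h /=; rewrite /GRing.scale /= mulr1 [h + t]addrC.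
split=> [[du <-]|H].
  have H : (fun h : R => h^-1 *: ((u \o shift t) (h *: (1 : R)) - u t)) @ (0 : R)^' -->
    'D_1 u t by exact: du.
  by rewrite E in H.
have H' : (fun h : R => h^-1 *: ((u \o shift t) (h *: (1 : R)) - u t)) @ (0 : R)^' --> d.
  by rewrite E.
apply: DeriveDef; first by apply/cvg_ex; exists d.
exact: cvg_lim H'.
Qed.

Lemma hausdorffR : hausdorff_space R^o.
Proof. exact: norm_hausdorff. Qed.

Lemma open_sym_itv (e : R) : open (sym_itv e).
Proof. exact: interval_open. Qed.

Lemma sym_itvP (e s : R) : sym_itv e s <-> `|s| < e.
Proof. by rewrite /sym_itv /= in_itv /= ltr_norml. Qed.

Lemma sym_itv0 (e : R) : 0 < e -> sym_itv e 0.
Proof. by move=> e0; apply/sym_itvP; rewrite normr0. Qed.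

Lemma nbhs_sym_itv (e : R) : 0 < e -> nbhs (0 : R) (sym_itv e).
Proof.
move=> e0; apply: open_nbhs_nbhs; split; first exact: open_sym_itv.
exact: sym_itv0.
Qed.

Lemma open_sym_itv_sub (U : set R) t : open U -> U t ->
  exists2 e : R, 0 < e & forall s, sym_itv e s -> U (t + s).
Proof.
move=> oU Ut; have [e /= e0 He] := open_nbhs_nbhs (conj oU Ut : open_nbhs t U).
exists e => // s /sym_itvP se; apply: He.
by rewrite /= opprD addrA subrr sub0r normrN.
Qed.

End RealVelocity.

(** * Degenerate inertia operators and the reduction by K *)

Section Inertia.
Context {R : realType} {E : tvsType R} {G : groupType} (S : lie_structure E G).
Context (K : set G) (A : E -> E -> R).

Local Notation smoothG := (smooth_into (atlas S)).
Local Notation tangent1 := (tangent1 S).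
Local Notation bracket := (bracket S).
Local Notation Ad := (Ad S).
Local Notation rlog := (rlog S).

Let hE : hausdorff_space E := model_hausdorff S.

Lemma rlogM (V : tvsType R) (U : set V) (F1 F2 : V -> G) x v : open U ->
  smoothG U F1 -> smoothG U F2 -> U x ->
  rlog (fun y => F1 y * F2 y)%g x v = rlog F1 x v + Ad (F1 x) (rlog F2 x v).
Proof.
move=> oU S1 S2 Ux.
apply: tangent1_unique (tangent1_rlog_line v oU (smoothG_mul S1 S2) Ux) _.
have := tangent1_mul (tangent1_rlog_line v oU S1 Ux)
  (tangent1_conj (F1 x) (tangent1_rlog_line v oU S2 Ux)).
apply: tangent1_near; apply: filterE => s.
by rewrite invgM !mulgA mulgVK.
Qed.

Lemma lie_tangent w : lie_algebra_of S K w -> exists2 e : R, 0 < e &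
  exists k : R -> G, [/\ smooth_curve S (sym_itv e) k,
    forall t, sym_itv e t -> K (k t), k 0 = 1%g & tangent1 k w].
Proof.
move=> [e e0 [k [Sk Kk k0 kw]]]; exists e => //; exists k; split => //.
have e00 := sym_itv0 e0.
have := tangent1_rlog_line (V := R^o) 1 (@open_sym_itv R e) Sk e00.
rewrite -rvelE kw k0; apply: tangent1_near; apply: filterE => s.
by rewrite add0r invg1 mulg1 /GRing.scale /= mulr1.
Qed.

(** The curve [s |-> k (t + s) (k t)^-1] stays in [K] and passes through the
   identity. *)
Lemma tangent_lie (U : set R) (k : R -> G) t : open U -> smooth_curve S U k ->
  (forall s, U s -> K (k s)) -> U t -> is_subgroup K ->
  lie_algebra_of S K (rvel S k t).
Proof.
move=> oU Sk Kk Ut [K1 KM KV]; have [e e0 He] := open_sym_itv_sub oU Ut.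
have e00 := sym_itv0 e0.
have Sk' : smooth_curve S (sym_itv e) (fun s => k (t + s) * (k t)^-1)%g.
  apply: (rtrans_smoothG (V := R^o) _ (@open_sym_itv R e)).
  apply: (smoothG_comp (V := R^o) (W := R^o) (U' := U) (u := fun s => t + s) (f := k)) => //.
  apply: smooth_add; first exact: open_sym_itv.
    exact: smooth_cst.
  exact: smooth_id.
exists e => //; exists (fun s => k (t + s) * (k t)^-1)%g; split => //.
- by move=> s /He Us; apply: KM; [exact: Kk|apply: KV; exact: Kk].
- by rewrite addr0 mulgV.
- rewrite !rvelE.
  apply: tangent1_unique (tangent1_rlog_line (V := R^o) 1 (@open_sym_itv R e) Sk' e00) _.
  have := tangent1_rlog_line (V := R^o) 1 oU Sk Ut.
  apply: tangent1_near; apply: filterE => s.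
  by rewrite !addr0 mulgV invg1 mulg1 add0r.
Qed.

Context (hK : is_subgroup K) (hA : inertia_operator A)
  (hker : [set v | A v = (fun _ => 0)] = lie_algebra_of S K)
  (hinv : forall k v, K k -> energy A (Ad k v) = energy A v).

Lemma inertia_bilinear : @bilinear_map R E E R^o A.
Proof.
have l Y : @linear_map R E R^o (A ^~ Y).
  by move=> a x y; exact: (inertia_linear hA).
split => // x a y z; rewrite !(inertia_sym hA x); exact: l.
Qed.

Lemma inertia_jointly_continuous : continuous (fun p : E * E => (A p.1 p.2 : R^o)).
Proof. exact: (inertia_continuous hA). Qed.

Lemma inertiaC v w : A v w = A w v.
Proof. exact: (inertia_sym hA). Qed.

Lemma inertiaDl v w Y : A (v + w) Y = A v Y + A w Y.
Proof. by rewrite (linear_mapD _ _ (inertia_bilinear.2 Y)). Qed.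

Lemma inertiaBl v w Y : A (v - w) Y = A v Y - A w Y.
Proof. by rewrite (linear_mapB _ _ (inertia_bilinear.2 Y)). Qed.

Lemma inertiaDr v w Y : A Y (v + w) = A Y v + A Y w.
Proof. by rewrite (linear_mapD _ _ (inertia_bilinear.1 Y)). Qed.

Lemma inertiaNr v Y : A Y (- v) = - A Y v.
Proof. by rewrite (linear_mapN _ (inertia_bilinear.1 Y)). Qed.

Lemma lie_ker w : lie_algebra_of S K w <-> forall Y, A w Y = 0.
Proof.
rewrite -hker /=; split => [-> //|H]; exact/funext.
Qed.

(** Polarization of the invariance of the energy. *)
Lemma inertia_Ad_isometry k v w : K k -> A (Ad k v) (Ad k w) = A v w.
Proof.
move=> Kk; have := hinv (v + w) Kk.
have := hinv v Kk; have := hinv w Kk; rewrite /energy.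
rewrite (linear_mapD _ _ (Ad_linear S k)) !inertiaDl !inertiaDr.
by rewrite (inertiaC (Ad k w) (Ad k v)) (inertiaC w v); lra.
Qed.

Lemma inertia_Ad k v : K k -> A (Ad k v) = coad S k (A v).
Proof.
by move=> Kk; apply/funext => Y; rewrite /coad -{1}[Y](AdKV S k) inertia_Ad_isometry.
Qed.

Lemma coadM a b m : coad S a (coad S b m) = coad S (a * b)%g m.
Proof. by apply/funext => Y; rewrite /coad invgM AdM. Qed.

Lemma coad1 m : coad S 1%g m = m.
Proof. by apply/funext => Y; rewrite /coad invg1 Ad1. Qed.

Lemma K_orbit_coad k m : K k -> K_orbit S K (coad S k m) = K_orbit S K m.
Proof.
have [K1 KM KV] := hK.
move=> Kk; apply/seteqP; split => _ [l Kl <-].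
  by exists (l * k)%g; rewrite ?coadM //; exact: KM.
exists (l * k^-1)%g; first by apply: KM => //; exact: KV.
by rewrite coadM mulgVK.
Qed.

Lemma K_orbit_refl m : K_orbit S K m m.
Proof. by have [K1 _ _] := hK; exists 1%g => //; rewrite coad1. Qed.

Lemma imA_coad k m : K k -> imA A m -> imA A (coad S k m).
Proof. by move=> Kk [v _ <-]; exists (Ad k v) => //; rewrite inertia_Ad. Qed.

Lemma right_coset_eq a b : right_coset K a = right_coset K b -> K (b * a^-1)%g.
Proof.
have [K1 _ _] := hK => ab.
have : right_coset K b b by exists 1%g => //; rewrite mul1g.
by rewrite -ab => -[k Kk <-]; rewrite mulgK.
Qed.

Lemma right_cosetM k a : K k -> right_coset K (k * a)%g = right_coset K a.
Proof.
have [K1 KM KV] := hK.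
move=> Kk; apply/seteqP; split => _ [l Kl <-].
  by exists (l * k)%g; rewrite ?mulgA //; exact: KM.
exists (l * k^-1)%g; first by apply: KM => //; exact: KV.
by rewrite mulgA mulgVK.
Qed.

(** The lifts differ by the curve [h g^-1] of [K], whose right velocity is in
   the kernel of [A]; the product rule [rlogM] gives the rest. *)
Lemma lift_change (I : set R) c g h t : open I ->
  smooth_lift S K I c g -> smooth_lift S K I c h -> I t ->
  exists k, K k /\ A (rvel S h t) = A (Ad k (rvel S g t)).
Proof.
move=> oI [Sg cg] [Sh ch] It.
pose k s := (h s * (g s)^-1)%g.
have Sk : smooth_curve S I k by apply: smoothG_mul => //; exact: smoothG_inv.
have Kk s : I s -> K (k s).
  by move=> Is; apply: right_coset_eq; rewrite -cg // -ch.
exists (k t); split; first exact: Kk.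
have /lie_ker kw := tangent_lie oI Sk Kk It hK.
suff -> : rvel S h t = rvel S k t + Ad (k t) (rvel S g t).
  by apply/funext => Y; rewrite inertiaDl kw add0r.
have -> : h = (fun s => k s * g s)%g by apply/funext => s; rewrite /k mulgVK.
by rewrite !rvelE; exact: (rlogM (V := R^o) 1 oI Sk Sg It).
Qed.

Lemma quotient_energyE (I : set R) c g t : open I -> smooth_lift S K I c g ->
  I t -> quotient_energy S K A I c t = energy A (rvel S g t).
Proof.
move=> oI cg It; apply: xget_unique; first by exists g.
move=> e [h ch ->]; have [k [Kk hk]] := lift_change oI cg ch It.
rewrite -(hinv (rvel S g t) Kk) /energy hk.
by rewrite [in LHS]inertiaC hk.
Qed.

Lemma momentum_orbit (I : set R) c g h t : open I -> smooth_lift S K I c g ->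
  smooth_lift S K I c h -> I t ->
  K_orbit S K (A (rvel S h t)) = K_orbit S K (A (rvel S g t)).
Proof.
move=> oI cg ch It; have [k [Kk hk]] := lift_change oI cg ch It.
by rewrite hk inertia_Ad // K_orbit_coad.
Qed.

Lemma bracketDl X Y Z : bracket (X + Y) Z = bracket X Z + bracket Y Z.
Proof. by rewrite (linear_mapD _ _ (bracket_linear_l S Z)). Qed.

Lemma bracketDr X Y Z : bracket Z (X + Y) = bracket Z X + bracket Z Y.
Proof. by rewrite (linear_mapD _ _ (bracket_linear_r S Z)). Qed.

Lemma adstar_ambiguity v v' : A v = A v' -> exists2 w, lie_algebra_of S K w &
  forall Y, adstar S v (A v) Y = adstar S v' (A v) Y + adstar S w (A v) Y.
Proof.
move=> vv'; exists (v - v').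
  by apply/lie_ker => Y; rewrite inertiaBl vv' subrr.
by move=> Y; rewrite /adstar -inertiaDr -bracketDl addrC subrK.
Qed.

(** The inverse makes the sign right: [coad k] pairs with [Ad k^-1]. *)
Lemma is_derive_coad k m w Y : imA A m -> tangent1 k w ->
  is_derive (0 : R) (1 : R) (fun s => coad S (k s)^-1%g m Y) (adstar S w m Y).
Proof.
move=> [v _ <-] kw; apply/is_derive_velocity; rewrite /coad /adstar.
have cA : continuous (A v : E -> R^o).
  have cv : continuous (fun Y : E => (v, Y)).
    by apply: continuous_pairT => x; [exact: cvg_cst|exact: cvg_id].
  exact: continuous_compT cv inertia_jointly_continuous.
have := has_velocity_linear (inertia_bilinear.1 v) cA (has_velocity_Ad_cst (Y := Y) kw).
move=> H; apply: eq_has_velocity H => s; by rewrite invgK.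
Qed.

Lemma adstar_equivariant k v :
  adstar S (Ad k v) (coad S k (A v)) = coad S k (adstar S v (A v)).
Proof. by apply/funext => Y; rewrite /adstar /coad Ad_bracket AdK. Qed.

(** The derivative of [A (Ad k v) (Ad k X)], which is constant along a curve
   [k] of [K]. *)
Lemma inertia_bracket_skew w v X : lie_algebra_of S K w ->
  A (bracket w v) X + A v (bracket w X) = 0.
Proof.
move=> /lie_tangent [e e0 [k [Sk Kk k0 kw]]].
have H := has_velocity_bilinear inertia_bilinear inertia_jointly_continuous
  (has_velocity_Ad_cst (Y := v) kw) (has_velocity_Ad_cst (Y := X) kw).
rewrite k0 !Ad1 addrC in H; apply: (has_velocity_unique hausdorffR H).
apply: has_velocity_near (has_velocity_cst (A v X : R^o) 0).
by apply: filterS (nbhs_sym_itv e0) => s /Kk Ks; rewrite inertia_Ad_isometry.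
Qed.

(** [f] is constant along the [K]-orbit of [A v], the image of a curve with
   velocity [bracket w v]; hence [A (bracket w v) X] vanishes, and
   [inertia_bracket_skew] moves [w] to the other argument. *)
Lemma differential_lie f v w X : K_invariant S K A f ->
  has_differential A f (A v) X -> lie_algebra_of S K w -> A v (bracket w X) = 0.
Proof.
move=> Kf fX lw; have [e e0 [k [Sk Kk k0 kw]]] := lie_tangent lw.
suff H : A (bracket w v) X = 0.
  by have := inertia_bracket_skew v X lw; rewrite H add0r.
have := fX _ _ _ (has_velocity_Ad_cst (Y := v) kw).
rewrite k0 Ad1 => /(_ erefl) /is_derive_velocity H.
apply: (has_velocity_unique hausdorffR H).
apply: has_velocity_near (has_velocity_cst (f (A v) : R^o) 0).
by apply: filterS (nbhs_sym_itv e0) => s /Kk Ks; rewrite inertia_Ad // Kf //; exists v.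
Qed.

(** Differentials at [A v] are compared on the affine curves through [v]. *)
Lemma differential_unique f v X X' : has_differential A f (A v) X ->
  has_differential A f (A v) X' -> lie_algebra_of S K (X' - X).
Proof.
move=> fX fX'; apply/lie_ker => d; rewrite inertiaC inertiaDr inertiaNr.
have v0 : A (v + 0 *: d) = A v by rewrite scale0r addr0.
have ud := @has_velocity_line R E v d 0.
have /is_derive_velocity H := fX (fun s => v + s *: d) d v0 ud.
have /is_derive_velocity H' := fX' (fun s => v + s *: d) d v0 ud.
by rewrite (has_velocity_unique hausdorffR H H') subrr.
Qed.

(** Two differentials at the same point differ by an element of the Lie
   algebra of [K], whose contribution vanishes by [differential_lie]. *)
Lemma poissonE f1 f2 m X1 X2 : K_invariant S K A f1 -> K_invariant S K A f2 ->
  imA A m -> has_differential A f1 m X1 -> has_differential A f2 m X2 ->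
  poisson S A f1 f2 m = m (bracket X1 X2).
Proof.
move=> Kf1 Kf2 [v _ <-] fX1 fX2; rewrite /poisson.
set Y1 := xget _ _; set Y2 := xget _ _.
have fY1 : has_differential A f1 (A v) Y1.
  exact: (@xgetPex _ 0 [set X | has_differential A f1 (A v) X] (ex_intro _ X1 fX1)).
have fY2 : has_differential A f2 (A v) Y2.
  exact: (@xgetPex _ 0 [set X | has_differential A f2 (A v) X] (ex_intro _ X2 fX2)).
have E1 : A v (bracket (Y1 - X1) Y2) = 0.
  exact: differential_lie Kf2 fY2 (differential_unique fX1 fY1).
have E2 : A v (bracket X1 (Y2 - X2)) = 0.
  rewrite bracketC inertiaNr (differential_lie Kf1 fX1 (differential_unique fX2 fY2)).
  by rewrite oppr0.
have -> : Y1 = (Y1 - X1) + X1 by rewrite subrK.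
rewrite bracketDl inertiaDr E1 add0r.
have -> : Y2 = (Y2 - X2) + X2 by rewrite subrK.
by rewrite bracketDr inertiaDr E2 add0r.
Qed.

Lemma differential_coad f m k X : K_invariant S K A f -> K k -> imA A m ->
  has_differential A f m X -> has_differential A f (coad S k m) (Ad k X).
Proof.
have [K1 KM KV] := hK.
move=> Kf Kk Lm fX u d u0 ud.
have /fX := has_velocity_linear (@Ad_linear _ _ _ S k^-1%g)
  (@Ad_continuous _ _ _ S k^-1%g) ud.
rewrite inertia_Ad; last exact: KV.
rewrite u0 coadM mulVg coad1 => /(_ erefl) /is_derive_velocity H.
apply/is_derive_velocity.
have -> : A d (Ad k X) = A (Ad k^-1%g d) X.
  by rewrite -[in RHS](AdK S k X) inertia_Ad_isometry //; exact: KV.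
apply: eq_has_velocity H => s; rewrite inertia_Ad; last exact: KV.
by rewrite Kf //; [exact: KV|exists (u s)].
Qed.

Lemma poisson_invariant f1 f2 : K_invariant S K A f1 -> K_invariant S K A f2 ->
  differentiable_on_imA A f1 -> differentiable_on_imA A f2 ->
  K_invariant S K A (poisson S A f1 f2).
Proof.
move=> Kf1 Kf2 d1 d2 k m Kk Lm.
have [X1 fX1] := d1 m Lm; have [X2 fX2] := d2 m Lm.
rewrite (poissonE Kf1 Kf2 Lm fX1 fX2).
rewrite (poissonE Kf1 Kf2 (imA_coad Kk Lm) (differential_coad Kf1 Kk Lm fX1)
  (differential_coad Kf2 Kk Lm fX2)).
by rewrite -Ad_bracket /coad AdK.
Qed.

Lemma energy_LE v : energy_L A (A v) = energy A v.
Proof.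
rewrite /energy_L /energy; congr (_ * _).
set v' := xget _ _.
have E0 : A v' = A v.
  exact: (@xgetPex _ 0 [set v' | A v' = A v] (ex_intro _ v erefl)).
by rewrite inertiaC E0.
Qed.

Lemma energy_L_invariant : K_invariant S K A (energy_L A).
Proof. by move=> k m Kk [v _ <-]; rewrite -inertia_Ad // !energy_LE hinv. Qed.

Lemma energy_differential v : has_differential A (energy_L A) (A v) v.
Proof.
move=> u d u0 ud; apply/is_derive_velocity.
have H := has_velocityZ (a := 2^-1) (has_velocity_bilinear inertia_bilinear inertia_jointly_continuous ud ud).
have E0 : A (u 0) d = A d v by rewrite u0 inertiaC.
rewrite (inertiaC d (u 0)) E0 in H.
suff <- : 2^-1 *: ((A d v : R^o) + (A d v : R^o)) = A d v.
  by apply: eq_has_velocity H => s; rewrite energy_LE.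
by rewrite /GRing.scale /=; lra.
Qed.

Lemma differentialN f m X : has_differential A f m X ->
  has_differential A (fun m => - f m) m (- X).
Proof.
move=> fX u d u0 ud; have /is_derive_velocity H := fX u d u0 ud.
apply/is_derive_velocity; rewrite inertiaNr.
have := has_velocityZ (a := -1) H; rewrite scaleN1r.
by move=> H'; apply: eq_has_velocity H' => s; rewrite scaleN1r.
Qed.

(** If [d] is the velocity of [u], the equation says that [A d X] is [- A (u
   t) (bracket v X)] for every [X]. Applied to a differential [X] of [F], the
   left-hand side is the derivative of [F], and the right-hand side is the
   Poisson bracket, since minus the energy has differential [- v]. The
   invariance of the Poisson bracket carries the equality from [A (u t)] to
   the given point [m] of its orbit. *)
Lemma quotient_euler_hamiltonian (I : set R) (M : R -> set (E -> R)) : open I ->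
  quotient_euler_solution S K A I M ->
  hamiltonian_trajectory S K A (fun m => - energy_L A m) I M.
Proof.
move=> oI [u [ud Mu eu]] F dF t m It Lm Mtm.
have KF : K_invariant S K A (F \o K_orbit S K).
  by move=> k m' Kk Lm' /=; rewrite K_orbit_coad.
have KH : K_invariant S K A (fun m => - energy_L A m).
  by move=> k m' Kk Lm'; rewrite energy_L_invariant.
have dH : differentiable_on_imA A (fun m => - energy_L A m).
  by move=> m' [v _ <-]; exists (- v); exact/differentialN/energy_differential.
have [k Kk mk] : K_orbit S K m (A (u t)).
  by rewrite -Mtm Mu //; exact: K_orbit_refl.
rewrite -(poisson_invariant KH KF dH dF Kk Lm) mk.
have [v [vu ev]] := eu t It; have [d dt] := ud t It.
have Lu : imA A (A (u t)) by exists (u t).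
have [X FX] := dF _ Lu.
have HX := @energy_differential v; rewrite vu in HX.
rewrite (poissonE KH KF Lu (differentialN HX) FX).
apply/is_derive_velocity.
have dt' : has_velocity (fun s => u (t + s)) 0 d.
  by apply: has_velocity_shift; rewrite addr0.
have := FX (fun s => u (t + s)) d; rewrite addr0.
move=> /(_ erefl dt') /is_derive_velocity H.
have <- : A d X = A (u t) (bracket (- v) X).
  have -> : bracket (- v) X = - bracket v X.
    by rewrite (linear_mapN _ (bracket_linear_l S X)).
  rewrite inertiaNr; have /is_derive_velocity H1 := ev X.
  apply: (has_velocity_unique hausdorffR _ H1).
  have := has_velocity_bilinear inertia_bilinear inertia_jointly_continuous dt (has_velocity_cst X t).
  by rewrite (linear_map0 (inertia_bilinear.1 _)) add0r.
have {H} : @has_velocity R R^o (fun s => F (K_orbit S K (A (u s)))) t (A d X).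
  have H' : @has_velocity R R^o
    (fun s => (F \o K_orbit S K) (A (u (t + s)))) (- t + t) (A d X).
    by rewrite addNr.
  have := has_velocity_shift H'.
  by move=> H2; apply: eq_has_velocity H2 => s /=; rewrite addrA subrr add0r.
apply: has_velocity_near.
by apply: filterS (open_nbhs_nbhs (conj oI It)) => s Is; rewrite Mu.
Qed.

End Inertia.

(** * Integrals over segments *)

Section Integrals.
Context {R : realType}.
Local Notation mu := (@lebesgue_measure R).

Lemma integrable_segment (a b : R) (f : R -> R) :
  (forall t : R, a <= t <= b -> {for t, continuous f}) ->
  mu.-integrable `[a, b] (EFin \o f).
Proof.
move=> cf; apply: continuous_compact_integrable; first exact: segment_compact.
apply: continuous_in_subspaceT => t /set_mem /=; rewrite in_itv /= => tab.
exact: cf.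
Qed.

Lemma Rintegral_derive (a b : R) (f F : R -> R) : a < b ->
  (forall t : R, a <= t <= b -> {for t, continuous f}) ->
  (forall t : R, a <= t <= b -> is_derive t 1 F (f t)) ->
  \int[mu]_(t in `[a, b]) f t = F b - F a.
Proof.
move=> ab cf dF; rewrite /Rintegral.
rewrite (@continuous_FTC2 _ f F) //.
- apply: continuous_in_subspaceT => t /set_mem /=; rewrite in_itv /= => tab.
  exact: cf.
- have cF t : a <= t <= b -> {for t, continuous F}.
    by move=> /dF Ft; apply: differentiable_continuous; apply/derivable1_diffP; case: Ft.
  split.
  + by move=> t; rewrite in_itv /= => /andP[ta tb]; have [] := dF t (ltac:(lra)).
  + by apply: cvg_at_right_filter; apply: cF; lra.
  + by apply: cvg_at_left_filter; apply: cF; lra.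
- move=> t; rewrite in_itv /= => /andP[ta tb].
  by rewrite derive1E; have [_ ->] := dF t (ltac:(lra)).
Qed.

(** On the compact rectangle [[- e / 2, e / 2] x [a, b]] the derivative is
   bounded by a constant, which dominates the difference quotients. *)
Lemma derive_under_integral (e a b : R) (f f' : R -> R -> R) : 0 < e ->
  (forall s t : R, `|s| < e -> a <= t <= b -> is_derive s 1 (f ^~ t) (f' s t)) ->
  (forall s t : R, `|s| < e -> a <= t <= b ->
    {for (s, t), continuous (fun p : R * R => f p.1 p.2)}) ->
  (forall s t : R, `|s| < e -> a <= t <= b ->
    {for (s, t), continuous (fun p : R * R => f' p.1 p.2)}) ->
  is_derive (0 : R) 1 (fun s => \int[mu]_(t in `[a, b]) f s t)
    (\int[mu]_(t in `[a, b]) f' 0 t).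
Proof.
move=> e0 df cf cf'.
have half (s : R) : `]- (e / 2), e / 2[%classic s -> `|s| < e.
  by rewrite /= in_itv /= => /andP[s1 s2]; rewrite ltr_norml; lra.
have cpt : compact (`[- (e / 2), e / 2] `*` `[a, b]).
  by apply: compact_setX; exact: segment_compact.
have [M [_ HM]] : bounded_set ((fun p : R * R => f' p.1 p.2) @`
    (`[- (e / 2), e / 2] `*` `[a, b])).
  apply: compact_bounded; apply: continuous_compact cpt.
  apply: continuous_in_subspaceT => -[s t] /set_mem [/=].
  rewrite !in_itv /= => /andP[s1 s2] tab.
  by apply: cf' => //; rewrite ltr_norml; lra.
(* [HM] bounds the derivative by every constant above [M]. *)
pose C := `|M| + 1.
have C0 : 0 <= C by rewrite /C addr_ge0.
have fC (s t : R) : `]- (e / 2), e / 2[%classic s -> `[a, b]%classic t ->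
    `|partial1of2 f s t| <= C.
  move=> Hs Ht; rewrite /= in_itv /= in Ht.
  rewrite partial1of2E; have [_ ->] := df s t (half s Hs) Ht.
  apply: HM; first by rewrite /C; have := ler_norm M; lra.
  exists (s, t) => //; split => /=; last by rewrite in_itv.
  by move: Hs; rewrite /= !in_itv /= => /andP[/ltW -> /ltW ->].
have H := @cvg_differentiation_under_integral R _ _ mu f `[a, b]%classic _ 0
  (- (e / 2)) (e / 2) _ _ _ (fun=> C) _ _ fC.
have {H} : h^-1 *: ((fun s : R => \int[mu]_(t in `[a, b]) f s t) (h + 0) -
    (fun s : R => \int[mu]_(t in `[a, b]) f s t) 0) @[h --> 0^'] -->
    \int[mu]_(t in `[a, b]) partial1of2 f 0 t.
  apply: H => //.
  - by rewrite /= in_itv /=; lra.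
  - move=> s Hs; apply: integrable_segment => t tab.
    have c1 : {for t, continuous (fun t : R => (s, t))}.
      exact: (cvg_pair (cvg_cst s) cvg_id).
    exact: (@continuous_comp _ _ _ (fun t : R => (s, t))
      (fun p : R * R => f p.1 p.2) t c1 (cf s t (half s Hs) tab)).
  - move=> s t Hs; rewrite /= in_itv /= => tab.
    by have [] := df s t (half s Hs) tab.
  - by apply: integrable_segment => t _; exact: cvg_cst.
have -> : \int[mu]_(t in `[a, b]) partial1of2 f 0 t = \int[mu]_(t in `[a, b]) f' 0 t.
  apply: eq_Rintegral => t /set_mem; rewrite /= in_itv /= => tab.
  by rewrite partial1of2E; have [_ ->] := df 0 t (ltac:(by rewrite normr0)) tab.
move=> H; apply/is_derive_velocity.
by apply: cvg_eqfun H _ => h; rewrite addr0 add0r.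
Qed.

End Integrals.

(** * The first variation of the action *)

Section FirstVariation.
Context {R : realType} {E : tvsType R} {G : groupType} (S : lie_structure E G).
Context (A : E -> E -> R) (hA : inertia_operator A).

Local Notation smoothG := (smooth_into (atlas S)).
Local Notation bracket := (bracket S).
Local Notation rlog := (rlog S).
Local Notation rvel := (rvel S).
Local Notation R2 := (R^o * R^o)%type.
Local Notation e1 := ((1, 0) : R^o * R^o).
Local Notation e2 := ((0, 1) : R^o * R^o).
Local Notation mu := (@lebesgue_measure R).

Let hE : hausdorff_space E := model_hausdorff S.
Let bA := inertia_bilinear hA.
Let cA := inertia_jointly_continuous hA.

Lemma bracket_bilinear : bilinear_map bracket.
Proof. by split => X; [exact: bracket_linear_r|exact: bracket_linear_l]. Qed.

Lemma rvel_slice2 (F : R2 -> G) s t : rvel (fun t => F (s, t)) t = rlog F (s, t) e2.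
Proof.
rewrite rvelE; apply: eq_velocity => r /=.
suff -> : ((s, t) : R2) + r *: e2 = (s, t + r *: (1 : R^o)) by [].
by congr pair; rewrite /= scaler0 addr0.
Qed.

Lemma rvel_slice1 (F : R2 -> G) s t : rvel (fun s => F (s, t)) s = rlog F (s, t) e1.
Proof.
rewrite rvelE; apply: eq_velocity => r /=.
suff -> : ((s, t) : R2) + r *: e1 = (s + r *: (1 : R^o), t) by [].
by congr pair; rewrite /= scaler0 addr0.
Qed.

Lemma rvel_smooth (I : set R) (g : R -> G) : open I -> smooth_curve S I g ->
  @smooth_on R R^o E I (rvel g).
Proof.
move=> oI Sg; apply: (@smooth_eq _ R^o E _ (fun t => @rlog R^o g t 1)) => //.
  by move=> t _; rewrite rvelE.
exact: (rlog_smooth_at (V := R^o) 1 oI Sg).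
Qed.

Definition acceleration (g : R -> G) (t : R) : E := @D R R^o E (rvel g) (t, 1).

Lemma has_velocity_rvel (I : set R) (g : R -> G) t : open I ->
  smooth_curve S I g -> I t -> has_velocity (rvel g) t (acceleration g t).
Proof.
move=> oI Sg It.
exact: (smooth_chain (V := R^o) (u := id) hE oI (rvel_smooth oI Sg) It
  (has_velocity_id t)).
Qed.

(** The pairing with [Y] of [dm/dt + ad^*_v m], where [v] is the right
   velocity of [g] and [m = A v]. *)
Definition euler_defect (g : R -> G) (t : R) (Y : E) : R :=
  A (acceleration g t) Y + A (rvel g t) (bracket (rvel g t) Y).

Lemma euler_atP (I : set R) (g : R -> G) t : open I -> smooth_curve S I g -> I t ->
  (forall Y, euler_defect g t Y = 0) <->
  euler_at S A (fun s => A (rvel g s)) t (rvel g t).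
Proof.
move=> oI Sg It.
have H Y : @has_velocity R R^o (fun s => A (rvel g s) Y) t (A (acceleration g t) Y).
  have := has_velocity_bilinear bA cA (has_velocity_rvel oI Sg It) (has_velocity_cst Y t).
  by rewrite (linear_map0 (bA.1 _)) add0r.
split=> [H0|[_ H0] Y].
  split => // Y; apply/is_derive_velocity; rewrite /adstar.
  have <- : A (acceleration g t) Y = - A (rvel g t) (bracket (rvel g t) Y).
    by apply/eqP; rewrite -addr_eq0; apply/eqP; exact: H0.
  exact: H.
have /is_derive_velocity := H0 Y.
move=> /(has_velocity_unique hausdorffR (H Y)).
by rewrite /euler_defect /adstar => ->; rewrite addNr.
Qed.

Lemma euler_defectZ g t (c : R) Y : euler_defect g t (c *: Y) = c * euler_defect g t Y.
Proof.
rewrite /euler_defect (linear_mapZ _ _ (bracket_linear_r S _)).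
by rewrite !(linear_mapZ _ _ (bA.1 _)) /GRing.scale /= mulrDr.
Qed.

Lemma euler_defect_smooth (I : set R) (g : R -> G) Y : open I -> smooth_curve S I g ->
  @smooth_on R R^o R^o I (fun t => euler_defect g t Y).
Proof.
move=> oI Sg; have Sv := rvel_smooth oI Sg.
apply: smooth_add => //; apply: (smooth_bilinear bA cA) => //.
- exact: (smooth_D_at (V := R^o) 1 hE oI Sv).
- exact: smooth_cst.
- apply: (@smooth_bilinear _ E E E R^o bracket I (rvel g) (fun=> Y)
    bracket_bilinear (@bracket_continuous _ _ _ S)) => //.
  exact: smooth_cst.
Qed.

Section Variation.
Variables (e : R) (J : set R) (F : R2 -> G) (a b : R).
Hypotheses (e0 : 0 < e) (oJ : open J) (ab : a < b)
  (abJ : forall t, a <= t <= b -> J t)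
  (SF : smoothG (sym_itv e `*` J) F).

Let U : set R2 := sym_itv e `*` J.

Let oU : open U.
Proof. exact: (openX (V := R^o) (W := R^o) (@open_sym_itv R e) oJ). Qed.

Let U_abs (s t : R) : `|s| < e -> a <= t <= b -> U (s, t).
Proof. by move=> se tab; split; [exact/sym_itvP|exact: abJ]. Qed.

Lemma smooth_slice2 s : sym_itv e s -> smooth_curve S J (fun t => F (s, t)).
Proof.
move=> se; apply: (smoothG_comp (V := R^o) (U' := U) (u := fun t => (s, t) : R2)) => //.
by apply: smooth_pair; [exact: smooth_cst|exact: smooth_id].
Qed.

Lemma smooth_slice1 t : J t -> smooth_curve S (sym_itv e) (fun s => F (s, t)).
Proof.
move=> Jt; apply: (smoothG_comp (V := R^o) (U' := U) (u := fun s => (s, t) : R2)) => //.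
by apply: smooth_pair; [exact: smooth_id|exact: smooth_cst].
Qed.

Let eta p := rlog F p e2.
Let xi p := rlog F p e1.

Let Seta : smooth_on U eta.
Proof. exact: rlog_smooth_at. Qed.

Let Sxi : smooth_on U xi.
Proof. exact: rlog_smooth_at. Qed.

Let has_velocity1 (f : R2 -> E) s t : smooth_on U f -> U (s, t) ->
  has_velocity (fun r => f (r, t)) s (D f ((s, t), e1)).
Proof.
move=> Sf Ust; apply: (smooth_chain (u := fun r => (r, t) : R2) hE oU Sf) => //.
by apply: has_velocity_pair; [exact: has_velocity_id|exact: has_velocity_cst].
Qed.

Let has_velocity2 (f : R2 -> E) s t : smooth_on U f -> U (s, t) ->
  has_velocity (fun r => f (s, r)) t (D f ((s, t), e2)).
Proof.
move=> Sf Ust; apply: (smooth_chain (u := fun r => (s, r) : R2) hE oU Sf) => //.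
by apply: has_velocity_pair; [exact: has_velocity_cst|exact: has_velocity_id].
Qed.

Let slice_cont (f : R2 -> R^o) t : smooth_on U f -> a <= t <= b ->
  {for t, continuous (fun t : R => f (0, t) : R)}.
Proof.
move=> Sf tab; have U0t : U (0, t) by apply: U_abs => //; rewrite normr0.
have c1 : {for t, continuous (fun t : R => (0, t) : R2)}.
  exact: (cvg_pair (cvg_cst (0 : R^o)) cvg_id).
exact: (@continuous_comp _ _ _ (fun t : R => (0, t) : R2) f t c1 (smooth_cont Sf U0t)).
Qed.

Lemma acceleration_slice t : acceleration (fun t => F (0, t)) t = D eta ((0, t), e2).
Proof.
apply: eq_velocity => r; rewrite rvel_slice2 /eta /=.
suff -> : ((0, t) : R2) + r *: e2 = (0, t + r *: (1 : R^o)) by [].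
by congr pair; rewrite /= scaler0 addr0.
Qed.

(** Let [xi] and [eta] be the right velocities of [F] in [s] and in [t]. The
   action varies by the integral of [A eta (d eta/ds)], where the Maurer-
   Cartan equation replaces [d eta/ds] by [d xi/dt + [xi, eta]]. Up to the
   Euler defect the result is the derivative of [A eta xi] in [t], whose
   integral vanishes by the conditions at the end points. *)
Theorem first_variation :
  A (rvel (fun t => F (0, t)) a) (rvel (fun s => F (s, a)) 0) = 0 ->
  A (rvel (fun t => F (0, t)) b) (rvel (fun s => F (s, b)) 0) = 0 ->
  is_derive (0 : R) (1 : R)
    (fun s => \int[mu]_(t in `[a, b]) energy A (rvel (fun t => F (s, t)) t))
    (- \int[mu]_(t in `[a, b])
        euler_defect (fun t => F (0, t)) t (rvel (fun s => F (s, t)) 0)).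
Proof.
move=> Aa Ab.
have S1 := smooth_D_at e1 hE oU Seta.
have S2 := smooth_D_at e2 hE oU Seta.
have S3 := smooth_D_at e2 hE oU Sxi.
pose f' p : R := A (eta p) (D eta (p, e1)).
have Sf : @smooth_on R R2 R^o U (fun p => A (eta p) (eta p)).
  exact: (smooth_bilinear bA cA).
have Sf' : @smooth_on R R2 R^o U f'.
  exact: (smooth_bilinear (f := eta) (g := fun p => D eta (p, e1)) bA cA oU Seta S1).
have H : is_derive (0 : R) 1
    (fun s => \int[mu]_(t in `[a, b]) energy A (eta (s, t)))
    (\int[mu]_(t in `[a, b]) f' (0, t)).
  apply: (derive_under_integral (f := fun s t => energy A (eta (s, t)))
    (f' := fun s t => f' (s, t)) e0).
  - move=> s t se tab; apply/is_derive_velocity.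
    have Hv := has_velocity1 Seta (U_abs se tab).
    have := has_velocityZ (a := 2^-1) (has_velocity_bilinear bA cA Hv Hv).
    rewrite (inertiaC hA (D eta _)) -/(f' (s, t)).
    suff -> : 2^-1 *: ((f' (s, t) : R^o) + (f' (s, t) : R^o)) = f' (s, t) by [].
    by rewrite /GRing.scale /=; lra.
  - move=> s t se tab.
    have -> : (fun p : R * R => energy A (eta (p.1, p.2))) =
        (fun p : R2 => 2^-1 *: (A (eta p) (eta p) : R^o)).
      by apply/funext => -[].
    by apply: cvgZ_tvs; [exact: cvg_cst|exact: (smooth_cont Sf (U_abs se tab))].
  - move=> s t se tab.
    have -> : (fun p : R * R => f' (p.1, p.2)) = f' by apply/funext => -[].
    exact: (smooth_cont Sf' (U_abs se tab)).
pose h' p : R := A (eta p) (D xi (p, e2)) + A (D eta (p, e2)) (xi p).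
pose d p : R := A (D eta (p, e2)) (xi p) + A (eta p) (bracket (eta p) (xi p)).
have Sh : @smooth_on R R2 R^o U h'.
  exact: (smooth_add oU
    (smooth_bilinear (f := eta) (g := fun p => D xi (p, e2)) bA cA oU Seta S3)
    (smooth_bilinear (f := fun p => D eta (p, e2)) (g := xi) bA cA oU S2 Sxi)).
have Sd : @smooth_on R R2 R^o U d.
  have Sb := smooth_bilinear (f := eta) (g := xi) bracket_bilinear
    (@bracket_continuous _ _ _ S) oU Seta Sxi.
  exact: (smooth_add oU
    (smooth_bilinear (f := fun p => D eta (p, e2)) (g := xi) bA cA oU S2 Sxi)
    (smooth_bilinear (f := eta) (g := fun p => bracket (eta p) (xi p))
       bA cA oU Seta Sb)).
have U0 t : a <= t <= b -> U (0, t) by apply: U_abs; rewrite normr0.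
have f'E t : a <= t <= b -> f' (0, t) = h' (0, t) - d (0, t).
  move=> tab; rewrite /f' /h' /d (maurer_cartan e1 e2 oU SF (U0 t tab)).
  rewrite -/(xi (0, t)) -/(eta (0, t)) (inertiaDr hA) (bracketC S (xi (0, t))).
  by rewrite (inertiaNr hA) opprD addrA addrK.
have If' : \int[mu]_(t in `[a, b]) f' (0, t) = - \int[mu]_(t in `[a, b]) d (0, t).
  have -> : \int[mu]_(t in `[a, b]) f' (0, t) =
      \int[mu]_(t in `[a, b]) (h' (0, t) - d (0, t)).
    by apply: eq_Rintegral => t /set_mem; rewrite /= in_itv /= => /f'E.
  rewrite (@RintegralB _ _ R mu `[a, b]%classic (fun t => h' (0, t))
    (fun t => d (0, t))) //; last 2 first.
  - by apply: integrable_segment => t tab; exact: slice_cont.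
  - by apply: integrable_segment => t tab; exact: slice_cont.
  have -> : \int[mu]_(t in `[a, b]) h' (0, t) =
      A (eta (0, b)) (xi (0, b)) - A (eta (0, a)) (xi (0, a)).
    apply: (@Rintegral_derive _ a b _ (fun t => A (eta (0, t)) (xi (0, t)))) => //.
      by move=> t tab; exact: slice_cont.
    move=> t tab; apply/is_derive_velocity.
    exact: (has_velocity_bilinear bA cA (has_velocity2 Seta (U0 t tab))
      (has_velocity2 Sxi (U0 t tab))).
  rewrite rvel_slice2 rvel_slice1 in Aa; rewrite rvel_slice2 rvel_slice1 in Ab.
  by rewrite /eta /xi Aa Ab subrr sub0r.
have dE : \int[mu]_(t in `[a, b]) d (0, t) = \int[mu]_(t in `[a, b])
    euler_defect (fun t => F (0, t)) t (rvel (fun s => F (s, t)) 0).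
  apply: eq_Rintegral => t _.
  by rewrite /euler_defect acceleration_slice rvel_slice2 rvel_slice1.
have valE := etrans If' (congr1 -%R dE).
have fE : (fun s => \int[mu]_(t in `[a, b]) energy A (eta (s, t))) =1
    (fun s => \int[mu]_(t in `[a, b]) energy A (rvel (fun t => F (s, t)) t)).
  by move=> s; apply: eq_Rintegral => t _; rewrite rvel_slice2.
apply/is_derive_velocity; apply: (eq_has_velocity2 fE valE).
exact/is_derive_velocity.
Qed.

End Variation.
End FirstVariation.

(** * Geodesics of G/K *)

Section Geodesics.
Context {R : realType} {E : tvsType R} {G : groupType} (S : lie_structure E G).
Context (K : set G) (A : E -> E -> R).
Context (hK : is_subgroup K) (hA : inertia_operator A)
  (hker : [set v | A v = (fun _ => 0)] = lie_algebra_of S K)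
  (hinv : forall k v, K k -> energy A (Ad S k v) = energy A v).

Local Notation smoothG := (smooth_into (atlas S)).
Local Notation log := (chart1 S).
Local Notation rvel := (rvel S).
Local Notation R2 := (R^o * R^o)%type.
Local Notation mu := (@lebesgue_measure R).

Let hE : hausdorff_space E := model_hausdorff S.
Let bA := inertia_bilinear hA.

Lemma path_actionE (J : set R) c g a b : open J -> smooth_lift S K J c g ->
  (forall t, a <= t <= b -> J t) ->
  path_action S K A J c a b = \int[mu]_(t in `[a, b]) energy A (rvel g t).
Proof.
move=> oJ cg abJ; apply: eq_Rintegral => t /set_mem; rewrite /= in_itv /= => tab.
exact: (quotient_energyE hK hA hker hinv oJ cg (abJ t tab)).
Qed.

Lemma action_variation (e : R) (J : set R) (F : R2 -> G) (C : R -> R -> set G)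
    (a b : R) : 0 < e -> open J -> a < b -> (forall t, a <= t <= b -> J t) ->
  smoothG (sym_itv e `*` J) F ->
  (forall s t, sym_itv e s -> J t -> C s t = right_coset K (F (s, t))) ->
  A (rvel (fun t => F (0, t)) a) (rvel (fun s => F (s, a)) 0) = 0 ->
  A (rvel (fun t => F (0, t)) b) (rvel (fun s => F (s, b)) 0) = 0 ->
  is_derive (0 : R) (1 : R) (fun s => path_action S K A J (C s) a b)
    (- \int[mu]_(t in `[a, b])
        euler_defect S A (fun t => F (0, t)) t (rvel (fun s => F (s, t)) 0)).
Proof.
move=> e0 oJ ab abJ SF CF Aa Ab; apply/is_derive_velocity.
have /is_derive_velocity := first_variation hA e0 oJ ab abJ SF Aa Ab.
apply: has_velocity_near.
apply: filterS (nbhs_sym_itv e0) => s se; apply/esym/path_actionE => //.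
by split; [exact: smooth_slice2 SF s se|move=> t; exact: CF].
Qed.

Lemma rvel_rtrans (g : R -> G) a t : rvel (fun s => g s * a)%g t = rvel g t.
Proof.
by apply: eq_velocity => s; rewrite invgM mulgA mulgK.
Qed.

(** Translated by [x^-1] on the right, the curve stays in [K] and keeps its
   right velocity, which is therefore in the kernel of [A]. *)
Lemma inertia_coset_velocity (e : R) (h : R -> G) (x : G) v : 0 < e ->
  smooth_curve S (sym_itv e) h ->
  (forall s, sym_itv e s -> right_coset K (h s) = right_coset K x) ->
  A v (rvel h 0) = 0.
Proof.
move=> e0 Sh hx; rewrite (inertiaC hA) -(rvel_rtrans h x^-1%g).
suff /(lie_ker hker) : lie_algebra_of S K (rvel (fun s => h s * x^-1)%g 0) by apply.
have s0 := sym_itv0 e0.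
have Sk : smooth_curve S (sym_itv e) (fun s => h s * x^-1)%g.
  exact: (rtrans_smoothG (V := R^o) _ (@open_sym_itv R e)).
apply: (tangent_lie (@open_sym_itv R e) Sk _ s0 hK) => s se.
by apply: (right_coset_eq hK); rewrite (hx s se).
Qed.

(** A variation of the curve of cosets is given with some lift. Multiplied on
   the left by a curve of [K], this lift starts at [g]; at the end points it
   moves inside a coset, so that [inertia_coset_velocity] gives the conditions
   of [first_variation]. *)
Lemma euler_geodesic (I : set R) (g : R -> G) : open I -> smooth_curve S I g ->
  (forall t Y, I t -> euler_defect S A g t Y = 0) ->
  geodesic S K A I (fun t => right_coset K (g t)).
Proof.
move=> oI Sg eul; split; first by exists g.
move=> e a b J C e0 ab oJ iJ abJ JI [C0 [F1 SF1 CF1]] Cab.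
have abJ' t : a <= t <= b -> J t by move=> tab; apply: abJ; rewrite /= in_itv.
have s0 := sym_itv0 e0.
have oU : open (sym_itv e `*` J : set R2).
  exact: (openX (V := R^o) (W := R^o) (@open_sym_itv R e) oJ).
(* The first two factors form a curve of [K]; at [q.1 = 0] they turn [F1] into
   [g]. *)
pose F (q : R2) := (g q.2 * (F1 ((0 : R^o), q.2))^-1 * F1 q)%g.
have SF : smoothG (sym_itv e `*` J) F.
  apply: smoothG_mul => //; apply: smoothG_mul; last apply: smoothG_inv.
    apply: (smoothG_comp (V := R2) (W := R^o) (U' := I) (u := snd) (f := g)) => //.
      by move=> q [_ /JI].
    exact: smooth_snd.
  apply: (smoothG_comp (V := R2) (W := R2) (U' := sym_itv e `*` J)
    (u := fun q => ((0 : R^o), q.2)) (f := F1)) => //.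
    by move=> q [].
  by apply: smooth_pair; [exact: smooth_cst|exact: smooth_snd].
have gF1 t : J t -> K (g t * (F1 (0, t))^-1)%g.
  move=> Jt; apply: (right_coset_eq hK).
  by rewrite -CF1 // C0.
have CF s t : sym_itv e s -> J t -> C s t = right_coset K (F (s, t)).
  by move=> se Jt; rewrite CF1 // /F (right_cosetM hK) //; exact: gF1.
have F0 : (fun t : R => F (0, t)) = g by apply/funext => t; rewrite /F /= mulgVK.
have Ja : J a by apply: abJ'; lra.
have Jb : J b by apply: abJ'; lra.
have Aa : A (rvel (fun t => F (0, t)) a) (rvel (fun s => F (s, a)) 0) = 0.
  apply: (inertia_coset_velocity (x := g a) _ e0 (smooth_slice1 SF Ja)) => s se.
  by rewrite -CF // (Cab s se).1.
have Ab : A (rvel (fun t => F (0, t)) b) (rvel (fun s => F (s, b)) 0) = 0.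
  apply: (inertia_coset_velocity (x := g b) _ e0 (smooth_slice1 SF Jb)) => s se.
  by rewrite -CF // (Cab s se).2.
have /is_derive_velocity H := action_variation e0 oJ ab abJ' SF CF Aa Ab.
apply/is_derive_velocity; apply: (eq_has_velocity2 _ _ H) => //.
apply/eqP; rewrite oppr_eq0; apply/eqP.
transitivity (\int[mu]_(t in `[a, b]) (0 : R)); last first.
  by rewrite Rintegral_cst // mul0r.
apply: eq_Rintegral => t /set_mem; rewrite /= in_itv /= => tab.
by rewrite F0 eul //; exact/JI/abJ'.
Qed.

Lemma ray_near (Y : E) : exists2 d : R, 0 < d &
  forall r : R, `|r| < d -> cran log (r *: Y).
Proof.
have : nbhs (0 *: Y) (cran log).
  rewrite scale0r; apply: open_nbhs_nbhs; split; first exact: cran_open.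
  exact: log_cran0.
move=> /(@continuous_scalel R E Y 0) [d /= d0 Hd].
by exists d => // r rd; apply: Hd; rewrite /= sub0r normrN.
Qed.

(** Variations only have to vanish at the end points of the segment, so a
   parabola does what a bump function would do. *)
Definition profile (t0 r t : R) : R := r ^+ 2 - (t - t0) ^+ 2.

Lemma profile_derive t0 r t : is_derive t (1 : R)
  (fun t => r ^+ 2 * (t - t0) - 3^-1 * (t - t0) ^+ 3) (profile t0 r t).
Proof.
by apply: is_derive_eq; rewrite /profile /GRing.scale /=; lra.
Qed.

Lemma profile_continuous t0 r : continuous (profile t0 r).
Proof.
move=> t; apply: cvgB; first exact: cvg_cst.
by apply: (continuous_comp (f := fun t => t - t0) (g := fun t => t ^+ 2));
  [apply: cvgB; [exact: cvg_id|exact: cvg_cst]|exact: exprn_continuous].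
Qed.

(** If the defect were positive at [t0], it would be bounded below on a
   neighbourhood, and the variation [ray Y (s * phi t) * g t], where [phi] is
   positive inside a small segment around [t0] and zero at its end points,
   would change the action at first order. *)
Lemma geodesic_euler_le0 (I : set R) (g : R -> G) t0 Y : open I ->
  smooth_curve S I g -> geodesic S K A I (fun t => right_coset K (g t)) -> I t0 ->
  euler_defect S A g t0 Y <= 0.
Proof.
move=> oI Sg [_ crit] It0; rewrite leNgt; apply/negP => pos.
set c := euler_defect S A g t0 Y in pos.
have Sd := euler_defect_smooth hA Y oI Sg.
have cd : {for t0, continuous (fun t => euler_defect S A g t Y : R^o)}.
  exact: (smooth_cont (V := R^o) Sd It0).
have /cd : nbhs (euler_defect S A g t0 Y : R^o) [set x | c / 2 < x].
  by apply: open_nbhs_nbhs; split; [exact: open_gt|rewrite /= -/c; lra].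
move=> /(filterI (open_nbhs_nbhs (conj oI It0 : open_nbhs t0 I))).
move=> [d /= d0 Hd].
pose r := d / 2; pose J := [set t : R | `|t - t0| < d].
have r0 : 0 < r by rewrite /r; lra.
have oJ : open J.
  have -> : J = ball t0 d by apply/funext => t; rewrite /J /ball /= distrC.
  exact: ball_open.
have JI t : J t -> I t /\ c / 2 < euler_defect S A g t Y.
  by move=> Jt; apply: Hd; rewrite /= distrC.
have iJ : is_interval J.
  move=> x y; rewrite /J /= !ltr_distl => /andP[x1 x2] /andP[y1 y2] z /andP[z1 z2].
  by rewrite ltr_distl; lra.
pose a := t0 - r; pose b := t0 + r.
have ab : a < b by rewrite /a /b; lra.
have abJ t : a <= t <= b -> J t.
  by rewrite /a /b /J /= ltr_distl /r => /andP[? ?]; lra.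
have [e1 e10 He1] := ray_near Y.
pose phi := profile t0 r.
(* For [`|s| < e] and [t] in [J], the time [s * phi t] of the ray is below [e1],
   because [phi] is bounded by [d ^+ 2] on [J]. *)
pose e := e1 / (d ^+ 2).
have e0 : 0 < e by rewrite divr_gt0 // exprn_gt0.
have phiJ t : J t -> `|phi t| < d ^+ 2.
  rewrite /J /= ltr_distl => /andP[t1 t2]; rewrite /phi /profile /r ltr_norml.
  have h : 0 < (d - (t - t0)) * (d + (t - t0)) by apply: mulr_gt0; lra.
  have d20 : 0 < d ^+ 2 by exact: exprn_gt0.
  have x20 : 0 <= (t - t0) ^+ 2 by exact: sqr_ge0.
  by apply/andP; split; lra.
pose F (q : R2) := (ray S Y (q.1 * phi q.2) * g q.2)%g.
have oU : open (sym_itv e `*` J : set R2).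
  exact: (openX (V := R^o) (W := R^o) (@open_sym_itv R e) oJ).
have SF : smoothG (sym_itv e `*` J) F.
  apply: smoothG_mul.
    apply: (smoothG_comp (V := R2) (W := E) (U' := cran log)
      (u := fun q : R2 => (q.1 * phi q.2) *: Y) (f := cinv log)) => //.
    - move=> [s t] [/sym_itvP se Jt]; apply: He1; rewrite normrM.
      have := phiJ t Jt => h1; rewrite /e ltr_pdivlMr ?exprn_gt0 // in se.
      apply: le_lt_trans se; apply: ler_wpM2l => //; exact: ltW.
    - apply: smooth_scale => //; last exact: smooth_cst.
      apply: (smooth_scale (W := R^o)) => //; first exact: smooth_fst.
      have -> : (fun q : R2 => phi q.2 : R^o) =
          (fun q : R2 => (r ^+ 2 : R^o) + (- 1 : R^o) *: ((q.2 - t0) *: (q.2 - t0 : R^o))).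
        by apply/funext => q; rewrite /phi /profile /GRing.scale /= mulN1r expr2.
      have St : @smooth_on R R2 R^o (sym_itv e `*` J) (fun q => q.2 - t0).
        by apply: smooth_add => //; [exact: smooth_snd|exact: smooth_cst].
      apply: smooth_add => //; first exact: smooth_cst.
      by apply: smooth_scale => //; [exact: smooth_cst|exact: smooth_scale].
    - exact: smoothG_cinv (chart1_atlas S).
  apply: (smoothG_comp (V := R2) (W := R^o) (U' := I) (u := snd) (f := g)) => //.
    by move=> q [_ /JI []].
  exact: smooth_snd.
have ray0 : ray S Y 0 = 1%g by rewrite /ray scale0r cinv_log0.
have F0 : (fun t : R => F (0, t)) = g.
  by apply/funext => t; rewrite /F /= mul0r ray0 mul1g.
have xiE t : rvel (fun s => F (s, t)) 0 = phi t *: Y.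
  apply: tangent1_velocity; have := tangent1_affine (phi t) (tangent1_ray S Y).
  apply: tangent1_near; apply: filterE => s.
  by rewrite /F /= mul0r ray0 mul1g mulgK mulrC.
pose C s t := right_coset K (F (s, t)).
have phia : phi a = 0 by rewrite /phi /profile /a; ring.
have phib : phi b = 0 by rewrite /phi /profile /b; ring.
have bnd t : phi t = 0 -> A (rvel (fun t => F (0, t)) t) (rvel (fun s => F (s, t)) 0) = 0.
  by move=> pt; rewrite xiE pt scale0r (linear_map0 (bA.1 _)).
have CF s t : sym_itv e s -> J t -> C s t = right_coset K (F (s, t)) by [].
have /is_derive_velocity D1 :=
  action_variation e0 oJ ab abJ SF CF (bnd a phia) (bnd b phib).
have /is_derive_velocity D2 : is_derive (0 : R) (1 : R)
    (fun s : R => path_action S K A J (C s) a b) 0.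
  have abJ' : [set` `[a, b]] `<=` J by move=> t; rewrite /= in_itv /=; exact: abJ.
  have JI' : J `<=` I by move=> t /JI [].
  apply: (crit e a b J C) => //.
  - split; last by exists F.
    by move=> t Jt; rewrite /C; have /(congr1 (fun h => h t)) := F0 => ->.
  - move=> s se; rewrite /C /F /= phia phib !mulr0 ray0 !mul1g //.
have := has_velocity_unique hausdorffR D1 D2.
move=> /eqP; rewrite oppr_eq0 => /eqP I0.
have phi0 t : a <= t <= b -> 0 <= phi t.
  by rewrite /a /b /phi /profile => /andP[t1 t2]; nra.
have cphi t : {for t, continuous phi} by exact: profile_continuous.
have Iphi : mu.-integrable `[a, b] (EFin \o phi).
  by apply: integrable_segment => t _.
have Vphi : \int[mu]_(t in `[a, b]) phi t = 4 / 3 * r ^+ 3.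
  apply: etrans (@Rintegral_derive _ a b phi
    (fun t => r ^+ 2 * (t - t0) - 3^-1 * (t - t0) ^+ 3) ab _ _) _ => //.
    by move=> t _; exact: profile_derive.
  by rewrite /a /b; lra.
have I1 : \int[mu]_(t in `[a, b]) (phi t * euler_defect S A g t Y) = 0.
  apply: etrans I0; apply: eq_Rintegral => t _.
  by rewrite xiE (euler_defectZ S hA) F0.
have cdef t : a <= t <= b -> {for t, continuous (fun t => euler_defect S A g t Y)}.
  by move=> tab; have [It _] := JI t (abJ t tab); exact: (smooth_cont (V := R^o) Sd It).
have le1 : \int[mu]_(t in `[a, b]) (c / 2 * phi t) <=
    \int[mu]_(t in `[a, b]) (phi t * euler_defect S A g t Y).
  apply: (@le_Rintegral _ _ _ mu `[a, b]%classic (fun t => c / 2 * phi t)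
    (fun t => phi t * euler_defect S A g t Y)).
  - exact: measurable_itv.
  - apply: integrable_segment => t tab.
    exact: (cvgM (cvg_cst (c / 2)) (cphi t)).
  - apply: integrable_segment => t tab.
    exact: (cvgM (cphi t) (cdef t tab)).
  - move=> t; rewrite /= in_itv /= => tab.
    rewrite mulrC; apply: ler_wpM2l; first exact: phi0.
    by have [_ /ltW] := JI t (abJ t tab).
have I2 : \int[mu]_(t in `[a, b]) (c / 2 * phi t) = c / 2 * (4 / 3 * r ^+ 3).
  by rewrite RintegralZl // Vphi.
suff : 0 < c / 2 * (4 / 3 * r ^+ 3) by rewrite -I2 ltNge -I1 le1.
by apply: mulr_gt0; [lra|apply: mulr_gt0; [lra|exact: exprn_gt0]].
Qed.

(** The defect is linear in [Y]. *)
Lemma geodesic_euler (I : set R) (g : R -> G) t Y : open I ->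
  smooth_curve S I g -> geodesic S K A I (fun t => right_coset K (g t)) -> I t ->
  euler_defect S A g t Y = 0.
Proof.
move=> oI Sg geo It; apply/eqP; rewrite eq_le (geodesic_euler_le0 Y oI Sg geo It) /=.
have := geodesic_euler_le0 (-1 *: Y) oI Sg geo It.
by rewrite (euler_defectZ S hA) mulN1r oppr_le0.
Qed.

End Geodesics.

(** * The Hamiltonian form of the Euler equation *)

Theorem theorem4p6 (R : realType) (E : tvsType R) (G : groupType)
    (S : lie_structure E G) (K : set G) (A : E -> E -> R)
    (hK : is_subgroup K)
    (hA : inertia_operator A)
    (hker : [set v | A v = (fun _ => 0)] = lie_algebra_of S K)
    (hinv : forall k v, K k -> energy A (Ad S k v) = energy A v) :
  (* the form generated by the energy descends to G/K, and the momentum of a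
     curve of G/K is well defined in L/K *)
  (forall (I : set R) (c : R -> set G) (g : R -> G), open I -> is_interval I ->
     smooth_lift S K I c g ->
     (forall t, I t ->
        quotient_energy S K A I c t = energy A (rvel S g t)) /\
     (forall h, smooth_lift S K I c h -> forall t, I t ->
        K_orbit S K (A (rvel S h t)) = K_orbit S K (A (rvel S g t))))
  /\
  (* the equation dm/dt = - ad^*_{A^-1 m} m on L descends to L/K: its
     right-hand side is defined up to vectors ad^*_w m with w in the Lie
     algebra of K, these are tangent to the K-orbit of m, and the right-hand
     side is K-equivariant *)
  (forall v v', A v = A v' -> exists2 w, lie_algebra_of S K w &
     forall Y, adstar S v (A v) Y = adstar S v' (A v) Y + adstar S w (A v) Y)
  /\
  (forall m w, imA A m -> lie_algebra_of S K w ->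
     exists2 e : R, 0 < e & exists k : R -> G,
       [/\ smooth_curve S (sym_itv e) k, forall s, sym_itv e s -> K (k s),
           k 0 = 1%g
         & forall Y, is_derive (0 : R) (1 : R)
             (fun s : R => coad S (k s) m Y) (adstar S w m Y)])
  /\
  (forall k v, K k ->
     A (Ad S k v) = coad S k (A v) /\
     adstar S (Ad S k v) (coad S k (A v)) = coad S k (adstar S v (A v)))
  /\
  (* the Euler equation of the geodesic flow is the quotient of this equation *)
  (forall (I : set R) (g : R -> G), open I -> is_interval I ->
     smooth_curve S I g ->
     (geodesic S K A I (fun t => right_coset K (g t)) <->
        forall t, I t -> euler_at S A (fun s => A (rvel S g s)) t (rvel S g t))
     /\
     (geodesic S K A I (fun t => right_coset K (g t)) ->
        quotient_euler_solution S K A I (fun t => K_orbit S K (A (rvel S g t)))))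
  /\
  (* the Lie-Poisson bracket is well defined on K-invariant functions on L,
     and its values are K-invariant functions *)
  (forall f1 f2 : (E -> R) -> R,
     K_invariant S K A f1 -> K_invariant S K A f2 ->
     differentiable_on_imA A f1 -> differentiable_on_imA A f2 ->
     (forall m X1 X2, imA A m ->
        has_differential A f1 m X1 -> has_differential A f2 m X2 ->
        poisson S A f1 f2 m = m (bracket S X1 X2)) /\
     K_invariant S K A (poisson S A f1 f2))
  /\
  (* the energy is a well-defined K-invariant function on L, with differential
     A^-1 m at m *)
  ((forall v, energy_L A (A v) = energy A v) /\
   K_invariant S K A (energy_L A) /\
   (forall v, has_differential A (energy_L A) (A v) v))
  /\
  (* the equation on L/K is Hamiltonian, with Hamiltonian function minus the
     energy *)
  (forall (I : set R) (M : R -> set (E -> R)), open I -> is_interval I ->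
     quotient_euler_solution S K A I M ->
     hamiltonian_trajectory S K A (fun m => - energy_L A m) I M).
Proof.
split; [|split; [|split; [|split; [|split; [|split; [|split]]]]]].
- move=> I c g oI _ cg; split => [t It|h ch t It].
    exact: (quotient_energyE hK hA hker hinv oI cg It).
  exact: (momentum_orbit hK hA hker hinv oI cg ch It).
- exact: (adstar_ambiguity hA hker).
- move=> m w Lm /lie_tangent [e e0 [k [Sk Kk k0 kw]]].
  have [_ _ KV] := hK; exists e => //; exists (fun s => (k s)^-1)%g; split.
  + exact: smoothG_inv.
  + by move=> s /Kk; exact: KV.
  + by rewrite k0 invg1.
  + by move=> Y; exact: (is_derive_coad hA).
- move=> k v Kk; split; first exact: (inertia_Ad hA hinv).
  exact: adstar_equivariant.
- move=> I g oI _ Sg.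
  have eulerP : geodesic S K A I (fun t => right_coset K (g t)) <->
      forall t, I t -> euler_at S A (fun s => A (rvel S g s)) t (rvel S g t).
    split=> [geo t It|eul].
      apply/(euler_atP hA oI Sg It) => Y.
      exact: (geodesic_euler hK hA hker hinv Y oI Sg geo It).
    apply: (euler_geodesic hK hA hker hinv oI Sg) => t Y It.
    by move: Y; apply/(euler_atP hA oI Sg It); exact: eul.
  split => // geo; exists (rvel S g); split => // t It.
    by exists (acceleration S g t); exact: (has_velocity_rvel oI Sg It).
  by exists (rvel S g t); exact: (eulerP.1 geo).
- move=> f1 f2 Kf1 Kf2 df1 df2; split.
    by move=> m X1 X2 Lm; exact: (poissonE hA hker hinv Kf1 Kf2 Lm).
  exact: (poisson_invariant hK hA hker hinv Kf1 Kf2 df1 df2).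
- split; [exact: (energy_LE hA)|split].
    exact: (energy_L_invariant hA hinv).
  exact: (energy_differential hA).
- move=> I M oI _; exact: (quotient_euler_hamiltonian hK hA hker hinv oI).
Qed.
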